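(* Let $d\ge 2$, $L\ge 0$ be integers and $n=\dim\mathcal{P}_L(\mathbb{S}^d)=\binom{d+L}{d}+\binom{d+L-1}{d}$. If $\{\boldsymbol{x}_i\}_{i=1}^n$ is an $n$-point harmonic ensemble on $\mathbb{S}^d$, then \[ \mathbb{E}\big(\mathrm{FP}(\{\boldsymbol{x}_i\}_{i=1}^n)\big)=\frac{n^2}{d+1}+\left(\frac{d}{L+d}-\frac{d(d-1)}{(d+L)(d+2L+1)(d+2L-1)}\right)\binom{d+L}{d}, \] and in particular $\mathbb{E}(\mathrm{FP}(\{\boldsymbol{x}_i\}_{i=1}^n))=\frac{n^2}{d+1}+O(n^{(d-1)/d})$ as $n\to\infty$.
   Context: $\mathbb{S}^d=\{\boldsymbol{x}\in\mathbb{R}^{d+1}:\|\boldsymbol{x}\|=1\}$, $\sigma_d$ the normalized surface measure on $\mathbb{S}^d$. Frame potential: $\mathrm{FP}(\{\boldsymbol{x}_i\}_{i=1}^n)=\sum_{i,j=1}^n|\langle\boldsymbol{x}_i,\boldsymbol{x}_j\rangle|^2$. $\mathcal{P}_L(\mathbb{S}^d)$ is the space of polynomials of degree at most $L$ in $d+1$ variables restricted to $\mathbb{S}^d$. Let $C_\ell^{((d-1)/2)}$ be the Gegenbauer polynomial (orthogonal on $[-1,1]$ w.r.t. $(1-x^2)^{d/2-1}$), $Q_\ell(x)=\frac{d+2\ell-1}{d-1}C_\ell^{((d-1)/2)}(x)$ and $R_L(x)=\sum_{\ell=0}^L Q_\ell(x)$; $R_L(\langle\boldsymbol{x},\boldsymbol{y}\rangle)$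 is the reproducing kernel of $\mathcal{P}_L(\mathbb{S}^d)$ with respect to $\sigma_d$. A determinantal point process (DPP) on a space $S$ with reference measure $\mu$ and kernel $\mathcal{K}$ is a simple point process $\mathcal{X}$ whose $k$-point correlation functions are $\rho_k(\boldsymbol{x}_1,\dots,\boldsymbol{x}_k)=\det(\mathcal{K}(\boldsymbol{x}_i,\boldsymbol{x}_j))_{i,j\le k}$, i.e. $\mathbb{E}[\sum^{\neq}_{\boldsymbol{x}_1,\dots,\boldsymbol{x}_k\in\mathcal{X}}h(\boldsymbol{x}_1,\dots,\boldsymbol{x}_k)]=\int\rho_k h\,d\mu^{\otimes k}$ for all Borel $h\ge0$, the sum over pairwise distinct tuples. The harmonic ensemble on $\mathbb{S}^d$ is the DPP on $\mathbb{S}^d$ with respect to $\sigma_d$ with kernel $\mathcal{K}(\boldsymbol{x},\boldsymbol{y})=R_L(\langle\boldsymbol{x},\boldsymbol{y}\rangle)$; it has almost surely $n=R_L(1)$ points. *)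

(* Defs.v *)
From HB Require Import structures.
From mathcomp Require Import all_boot all_order all_algebra.
From mathcomp Require Import all_classical all_reals all_analysis.
From mathcomp Require Import measurable_realfun.
Set Implicit Arguments. Unset Strict Implicit. Unset Printing Implicit Defensive.
Import Order.TTheory GRing.Theory Num.Theory.
Import numFieldNormedType.Exports.
Local Open Scope classical_set_scope.
Local Open Scope ring_scope.

(* Points of R^(d+1) are (d+1)-tuples of reals; the tuple type carries the
   product (Borel) sigma-algebra of the coordinate projections. *)
Notation pt R d := ((d.+1).-tuple R).

Section Defs.
Variable R : realType.

Definition dot (m : nat) (u v : m.-tuple R) : R := \sum_(i < m) tnth u i * tnth v i.

Definition vnorm (m : nat) (u : m.-tuple R) : R := Num.sqrt (dot u u).

Definition on_sphere (d : nat) (u : pt R d) : Prop := vnorm u = 1.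

Definition FP (d n : nat) (x : 'I_n -> pt R d) : R :=
  \sum_(i < n) \sum_(j < n) (dot (x i) (x j)) ^+ 2.

(* Lebesgue integral on R^m, written as an iterated integral over the
   coordinates (Tonelli: equal to the integral w.r.t. Lebesgue measure on R^m
   for nonnegative measurable integrands). *)
Fixpoint lint (m : nat) : (m.-tuple R -> \bar R) -> \bar R :=
  match m return (m.-tuple R -> \bar R) -> \bar R with
  | 0 => fun f => f [tuple]
  | m'.+1 => fun f =>
      (\int[@lebesgue_measure R]_t lint (fun y : m'.-tuple R => f (cons_tuple t y)))%E
  end.

Definition vscale (m : nat) (c : R) (u : m.-tuple R) : m.-tuple R :=
  map_tuple (fun a => c * a) u.

Definition cone_integrand (d : nat) (f : pt R d -> \bar R) (x : pt R d) : \bar R :=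
  if (0 < vnorm x) && (vnorm x <= 1) then f (vscale (vnorm x)^-1 x) else 0%E.

(* Integral against the normalized surface measure sigma_d on S^d, via the
   cone construction: sigma_d(A) = lambda_{d+1}({t a : a in A, 0 < t <= 1})
   / lambda_{d+1}(unit ball). *)
Definition sph_int (d : nat) (f : pt R d -> \bar R) : \bar R :=
  (lint (cone_integrand f) * ((fine (lint (cone_integrand (fun _ : pt R d => 1%E))))^-1)%:E)%E.

Fixpoint sph_intk (d k : nat) : (k.-tuple (pt R d) -> \bar R) -> \bar R :=
  match k return (k.-tuple (pt R d) -> \bar R) -> \bar R with
  | 0 => fun F => F [tuple]
  | k'.+1 => fun F =>
      sph_int (fun y : pt R d => sph_intk (fun ys : k'.-tuple (pt R d) => F (cons_tuple y ys)))
  end.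

(* Gegenbauer polynomials C_n^(lam), standard normalization (generating
   function (1 - 2xt + t^2)^(-lam)), via the three-term recurrence
   C_0 = 1, C_1 = 2 lam x,
   (n+1) C_{n+1} = 2 (n+lam) x C_n - (n + 2 lam - 1) C_{n-1}.
   gegp lam x n = (C_n(x), C_{n+1}(x)). *)
Fixpoint gegp (lam x : R) (n : nat) : R * R :=
  match n with
  | 0 => (1, 2 * lam * x)
  | m.+1 =>
      let: (a, b) := gegp lam x m in
      (b, (2 * (m.+1%:R + lam) * x * b - (m.+1%:R + 2 * lam - 1) * a) / m.+2%:R)
  end.

Definition gegenbauer (lam : R) (n : nat) (x : R) : R := (gegp lam x n).1.

Definition Qd (d l : nat) (x : R) : R :=
  ((d + 2 * l - 1)%N%:R / (d - 1)%N%:R) * gegenbauer ((d%:R - 1) / 2) l x.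

Definition RL (d L : nat) (x : R) : R := \sum_(l < L.+1) Qd d l x.

Definition hdim (d L : nat) : nat := 'C(d + L, d) + 'C(d + L - 1, d).

Definition rho (d L k : nat) (y : k.-tuple (pt R d)) : R :=
  \det (\matrix_(a < k, b < k) RL d L (dot (tnth y a) (tnth y b))).

(* {x_i}_{i<n}, n = hdim d L, is (a labelling of) the harmonic ensemble on S^d:
   measurable random points, a.s. on S^d and pairwise distinct (simple point
   process with n points), whose k-point correlation functions with respect to
   sigma_d are det(R_L(<y_a,y_b>)), for every k and every Borel h >= 0
   (the sum over pairwise distinct k-tuples of points of the process is the
   sum over injective index maps). *)
Definition harmonic_ensemble (d L : nat) {dO : measure_display}
  {Omega : measurableType dO} (P : probability Omega R)
  (x : 'I_(hdim d L) -> Omega -> pt R d) : Prop :=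
  (forall i, measurable_fun setT (x i)) /\
  {ae P, forall w, forall i, on_sphere (x i w)} /\
  {ae P, forall w, injective (fun i => x i w)} /\
  (forall (k : nat) (h : k.-tuple (pt R d) -> \bar R),
     measurable_fun [set: k.-tuple (pt R d)] h -> (forall z, (0 <= h z)%E) ->
     (\int[P]_w (\sum_(s : {ffun 'I_k -> 'I_(hdim d L)} | injectiveb s)
                   h [tuple x (s a) w | a < k])
      = sph_intk (fun y => (rho L y)%:E * h y))%E).

Definition EFP (d L : nat) {dO : measure_display} {Omega : measurableType dO}
  (P : probability Omega R) (x : 'I_(hdim d L) -> Omega -> pt R d) : \bar R :=
  (\int[P]_w (FP (fun i => x i w))%:E)%E.

End Defs.

(* Main.v *)
Require Import Defs.
From HB Require Import structures.
From mathcomp Require Import all_boot all_order all_algebra.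
From mathcomp Require Import all_classical all_reals all_analysis.
From mathcomp Require Import measurable_realfun ring lra zify.
Set Implicit Arguments. Unset Strict Implicit. Unset Printing Implicit Defensive.
Import Order.TTheory GRing.Theory Num.Theory.
Local Open Scope classical_set_scope.
Local Open Scope ring_scope.

(* The points have norm 1, so the diagonal terms of FP contribute n, and the
   2-point correlation function turns the off-diagonal terms into
   n^2/(d+1) - E[t^2 R_L(t)^2], where t = <x,y> with x fixed and y uniform.
   The law of t does not depend on x: a rotation moving x to a basis vector is
   a product of shears, under which iterated Lebesgue integrals are invariant
   by translation invariance and Fubini.  Rotations in the plane of two basis
   vectors give the moments of t, equivalently the Stein identity
   E[(1-t^2) p'(t) - d t p(t)] = 0.  With p = C_l' and the Gegenbauer equation
   it yields E[Q_l(t)] = 0 for l > 0, and the three-term recurrence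
   t Q_l = a_(l+1) Q_(l+1) + (1 - a_(l-1)) Q_(l-1), a_l = l/(2l+d-1), then
   gives E[Q_l Q_m] = 0 for l <> m and E[Q_l^2] = Q_l(1).  Summing it,
   t R_L = R_(L-1) + a_L Q_L + a_(L+1) Q_(L+1), whence
   E[t^2 R_L^2] = R_(L-1)(1) + a_L^2 Q_L(1) + a_(L+1)^2 Q_(L+1)(1). *)

(** * Translation invariance on the line *)

Section LebesgueLine.
Variable R : realType.
Local Notation mu := (@lebesgue_measure R).

(** Lebesgue measure is the only measure giving half-open intervals their length, and the
    pushforward by a translation does that too. *)
Lemma lebesgue_measure_translate (a : R) (A : set R) : measurable A ->
  pushforward mu ((fun t => t + a) : R -> measurableTypeR R) A = mu A.
Proof.
have mS : measurable_fun setT ((fun t : R => t + a) : R -> measurableTypeR R).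
  exact: measurable_funD.
move=> mA; apply/esym/(@lebesgue_measure_unique _
  (pushforward mu ((fun t => t + a) : R -> measurableTypeR R))) => //= _ [[b c]] _ <-.
rewrite /pushforward.
have -> : (fun t : R => t + a) @^-1` `]b, c] = `]b - a, c - a]%classic.
  by apply/seteqP; split => t /=; rewrite !in_itv/= ltrBlDr lerBrDr.
rewrite !lebesgue_measure_itv/= !lte_fin ltrD2r.
by case: ifP => // _; rewrite -!EFinB; congr EFin; ring.
Qed.

(** The working class of integrands: [C] bounds the values, [B] the support. All of them are
    integrable, so integrals can be handled as real numbers. *)
Definition bounded_by (B C : R) (g : R -> R) : Prop :=
  measurable_fun setT g /\ forall t, `|g t| <= C /\ (g t != 0 -> `|t| <= B).

Lemma bounded_by_integrable (B C : R) (g : R -> R) : bounded_by B C g ->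
  mu.-integrable setT (EFin \o g) /\ `|\int[mu]_t g t| <= C * (2 * `|B|).
Proof.
(* [g] is dominated by [C] times the indicator of [D]; the sign of [B] is not assumed, hence the
   absolute values. *)
move=> [mg bg]; pose D := `[- `|B|, `|B|]%classic.
have C0 : 0 <= C by apply: le_trans (bg 0).1.
have intC : mu.-integrable setT (EFin \o (fun t => C * \1_D t)).
  have := @integrable_indic_itv R (- `|B|) `|B| true false.
  by move=> /(integrableZl _ C) -/(_ measurableT).
have leC t : `|g t| <= C * \1_D t.
  rewrite indicE; have [gt|gt] := eqVneq (g t) 0.
    by rewrite gt normr0 mulr_ge0.
  have := (bg t).2 gt => tB.
  rewrite mem_set ?mulr1; first exact: (bg t).1.
  by rewrite /D/= in_itv/= -ler_norml (le_trans tB)// ler_norm.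
have intg : mu.-integrable setT (EFin \o g).
  apply: le_integrable intC => //; first exact/measurable_EFinP.
  move=> t _ /=; rewrite lee_fin (le_trans (leC t))// ler_norm//.
split => //.
apply: le_trans (le_normr_Rintegral _ _) _ => //.
apply: (@le_trans _ _ (\int[mu]_t (C * \1_D t))).
  apply: le_Rintegral => //.
  by have := integrable_norm intg; apply: eq_integrable.
rewrite RintegralZl//; last first.
  exact: (@integrable_indic_itv R (- `|B|) `|B| true false).
apply: ler_wpM2l => //.
rewrite /Rintegral integral_indic//; last exact: measurable_itv.
have e : mu D = (2 * `|B|)%:E.
  rewrite [LHS]lebesgue_measure_itv/= lte_fin; case: ifP => [_|]; first by rewrite -EFinD; congr EFin; lra.
  by move=> h; congr EFin; have := normr_ge0 B; lra.
rewrite setIT.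
have h z : z = mu D -> fine z <= 2 * `|B| by move=> ->; rewrite e.
exact: h.
Qed.

Lemma Rintegral_translate (a B C : R) (g : R -> R) : bounded_by B C g ->
  \int[mu]_t g (t + a) = \int[mu]_t g t.
Proof.
move=> bg; congr fine.
have mS : measurable_fun setT ((fun t : R => t + a) : measurableTypeR R -> measurableTypeR R).
  exact: measurable_funD.
have [ig _] := bounded_by_integrable bg.
have ig' : mu.-integrable setT (EFin \o (fun t => g (t + a))).
  apply: (@bounded_by_integrable (B + `|a|) C _ _).1; split.
    by apply: measurableT_comp; [exact: bg.1|exact: measurable_funD].
  move=> t; have [h1 h2] := bg.2 (t + a); split => // /h2 h.
  have := ler_normB (t + a) a; rewrite addrK; lra.
have := integral_pushforward mS (f := EFin \o g) _ ig' measurableT.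
rewrite preimage_setT => <-; last by apply/measurable_EFinP; exact: bg.1.
by apply: eq_measure_integral => A mA _; exact: lebesgue_measure_translate.
Qed.

End LebesgueLine.

(** * Iterated Lebesgue integrals *)

Section IteratedIntegral.
Variable R : realType.
Local Notation mu := (@lebesgue_measure R).

(** Real-valued counterpart of [lint]; [lintE] identifies the two on bounded functions of bounded
    support. *)
Fixpoint rlint (m : nat) : (m.-tuple R -> R) -> R :=
  match m return (m.-tuple R -> R) -> R with
  | 0 => fun f => f [tuple]
  | m'.+1 => fun f => \int[mu]_t rlint (fun y : m'.-tuple R => f (cons_tuple t y))
  end.

Lemma eq_rlint m (f g : m.-tuple R -> R) : f =1 g -> rlint f = rlint g.
Proof. by move=> fg; congr rlint; apply/funext. Qed.

Lemma measurable_Rintegral_param d (T : measurableType d) (g : T * measurableTypeR R -> R) :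
  measurable_fun setT g -> measurable_fun setT (fun t => \int[mu]_s g (t, s)).
Proof.
move=> mg; apply: (measurableT_comp (fine_measurable measurableT)).
have mG : measurable_fun setT (EFin \o g) by exact/measurable_EFinP.
have -> : (fun t => \int[mu]_s (g (t, s))%:E)%E =
    (fun t => fubini_F mu (EFin \o g)^\+ t - fubini_F mu (EFin \o g)^\- t)%E.
  apply/funext => t; rewrite integralE /fubini_F.
  by congr (_ - _)%E; apply: eq_integral => s _; rewrite ?funeposE ?funenegE.
apply: emeasurable_funB.
  by apply: measurable_fun_fubini_tonelli_F => //; exact: measurable_funepos.
by apply: measurable_fun_fubini_tonelli_F => //; exact: measurable_funeneg.
Qed.

(** The parameter space [T] is arbitrary because the induction on [m] absorbs the first coordinate
    of the tuple into the parameter. *)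
Lemma measurable_rlint_param d (T : measurableType d) m (f : T * m.-tuple R -> R) :
  measurable_fun setT f -> measurable_fun setT (fun t => rlint (fun y => f (t, y))).
Proof.
elim: m d T f => [|m IH] d T f mf /=.
  by apply: (measurableT_comp mf); exact: measurable_fun_pair.
pose g (z : T * measurableTypeR R) := rlint (fun y => f (z.1, cons_tuple z.2 y)).
apply: (@measurable_Rintegral_param _ T g).
apply: (IH _ _ (fun z : (T * measurableTypeR R) * m.-tuple R => f (z.1.1, cons_tuple z.1.2 z.2))).
apply: (measurableT_comp mf); apply: measurable_fun_pair.
  by apply: measurableT_comp => //; exact: measurable_fst.
apply: (@measurable_cons _ _ _ R (fun z : (T * measurableTypeR R) * m.-tuple R => z.1.2) m snd) => //.
exact: measurableT_comp.
Qed.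

(** The support lies in a cube rather than a ball, so fixing the first coordinate keeps both
    constants and inductions on [m] go through. *)
Definition bsupp (m : nat) (B C : R) (f : m.-tuple R -> R) : Prop :=
  measurable_fun setT f /\
  forall y, `|f y| <= C /\ (f y != 0 -> forall i, `|tnth y i| <= B).

Lemma bsupp_slice m (B C : R) (f : m.+1.-tuple R -> R) (t : R) :
  bsupp B C f -> bsupp B C (fun y => f (cons_tuple t y)).
Proof.
move=> [mf bf]; split=> [|y].
  by apply: (measurableT_comp mf); exact: (@measurable_cons _ _ _ R (cst t) m id).
have [h1 h2] := bf (cons_tuple t y); split=> // /h2 h i.
by have := h (lift ord0 i); rewrite tnthS.
Qed.

Lemma rlint0 m : rlint (fun _ : m.-tuple R => 0) = 0.
Proof.
elim: m => //= m IH; under eq_Rintegral do rewrite IH.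
by rewrite /Rintegral integral0.
Qed.

(** A slice at height [t] with [|t| > B] vanishes identically. The bound [D] is left as a hypothesis
    so that the lemma can serve inside the induction of [rlint_norm], which then supplies it. *)
Lemma bsupp_rlint_slices m (B C D : R) (f : m.+1.-tuple R -> R) : bsupp B C f ->
  (forall t, `|rlint (fun y => f (cons_tuple t y))| <= D) ->
  bounded_by B D (fun t => rlint (fun y => f (cons_tuple t y))).
Proof.
move=> bf leD; split=> [|t].
  apply: (@measurable_rlint_param _ _ _ (fun z : R * m.-tuple R => f (cons_tuple z.1 z.2))).
  by apply: (measurableT_comp bf.1); exact: (@measurable_cons _ _ _ R fst m snd).
split=> //; apply: contraNle => tB; rewrite -(rlint0 m); apply/eqP/eq_rlint => y.
apply/eqP; apply: contraTT tB => /(bf.2 _).2 /(_ ord0).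
by rewrite tnth0 -leNgt.
Qed.

Lemma rlint_norm m (B C : R) (f : m.-tuple R -> R) : bsupp B C f ->
  `|rlint f| <= C * (2 * `|B|) ^+ m.
Proof.
elim: m f => [|m IH] f bf /=; first by rewrite expr0 mulr1; exact: (bf.2 _).1.
have bd := bsupp_rlint_slices bf (fun t => IH _ (bsupp_slice t bf)).
by rewrite exprSr [leRHS]mulrA; exact: (bounded_by_integrable bd).2.
Qed.

Lemma bsupp_rlint m (B C : R) (f : m.+1.-tuple R -> R) : bsupp B C f ->
  bounded_by B (C * (2 * `|B|) ^+ m) (fun t => rlint (fun y => f (cons_tuple t y))).
Proof.
by move=> bf; apply: (bsupp_rlint_slices bf) => t; exact: rlint_norm (bsupp_slice t bf).
Qed.

Lemma rlint_integrable m (B C : R) (f : m.+1.-tuple R -> R) : bsupp B C f ->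
  mu.-integrable setT (EFin \o (fun t => rlint (fun y => f (cons_tuple t y)))).
Proof. by move=> /bsupp_rlint/bounded_by_integrable[]. Qed.

Lemma lintE m (B C : R) (f : m.-tuple R -> R) : bsupp B C f ->
  lint (fun y => (f y)%:E) = (rlint f)%:E.
Proof.
elim: m f => //= m IH f bf.
under eq_integral => t _ do rewrite (IH _ (bsupp_slice t bf)).
by rewrite /Rintegral fineK//; apply: integrable_fin_num => //; exact: rlint_integrable bf.
Qed.

Lemma rlintD m (B C D : R) (f g : m.-tuple R -> R) : bsupp B C f -> bsupp B D g ->
  rlint (fun y => f y + g y) = rlint f + rlint g.
Proof.
elim: m f g => //= m IH f g bf bg.
under eq_Rintegral => t _ do rewrite (IH _ _ (bsupp_slice t bf) (bsupp_slice t bg)).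
by rewrite RintegralD//; [exact: rlint_integrable bf|exact: rlint_integrable bg].
Qed.

Lemma rlintZ m (B C a : R) (f : m.-tuple R -> R) : bsupp B C f ->
  rlint (fun y => a * f y) = a * rlint f.
Proof.
elim: m f => //= m IH f bf.
under eq_Rintegral => t _ do rewrite (IH _ (bsupp_slice t bf)).
by rewrite RintegralZl//; exact: rlint_integrable bf.
Qed.

Lemma rlint_translate m (v : m.-tuple R) (B C : R) (f : m.-tuple R -> R) : bsupp B C f ->
  rlint (fun y => f [tuple tnth y i + tnth v i | i < m]) = rlint f.
Proof.
elim: m v f => [|m IH] v f bf /=; first by congr f; apply: tuple0.
rewrite -(Rintegral_translate (thead v) (bsupp_rlint bf)).
apply: eq_Rintegral => t _.
rewrite -(IH [tuple of behead v] _ (bsupp_slice _ bf)); apply: eq_rlint => y.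
congr f; apply: eq_from_tnth => i; rewrite !tnth_mktuple.
case: (unliftP ord0 i) => [j ->|->]; last by rewrite !tnth0.
by rewrite !tnthS tnth_mktuple tnth_behead; congr (_ + tnth v _); apply: val_inj; rewrite /= inordK// ltnS.
Qed.

(** Fubini's theorem; integrability on the plane follows from Tonelli, since the iterated integral
    of [|g|] is that of a bounded function of bounded support. *)
Lemma Rintegral_exchange (B C : R) (g : measurableTypeR R * measurableTypeR R -> R) :
  measurable_fun setT g ->
  (forall z, `|g z| <= C) -> (forall z, g z != 0 -> `|z.1| <= B /\ `|z.2| <= B) ->
  \int[mu]_t \int[mu]_s g (t, s) = \int[mu]_s \int[mu]_t g (t, s).
Proof.
move=> mg gC gB.
have C0 : 0 <= C by exact: le_trans (gC (0, 0)).
have b1 t : bounded_by B C (fun s => g (t, s)).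
  split=> [|s]; first by apply: (measurableT_comp mg); exact: measurable_fun_pair.
  by split=> // /gB[].
have b2 s : bounded_by B C (fun t => g (t, s)).
  split=> [|t]; first by apply: (measurableT_comp mg); exact: measurable_fun_pair.
  by split=> // /gB[].
have bn t : bounded_by B C (fun s => `|g (t, s)|).
  split=> [|s]; first by apply: measurableT_comp => //; exact: (b1 t).1.
  by rewrite normr_id normr_eq0; exact: (b1 t).2.
have E1 t : (\int[mu]_s (g (t, s))%:E)%E = (\int[mu]_s g (t, s))%:E.
  by rewrite /Rintegral fineK//; apply: integrable_fin_num => //; exact: (bounded_by_integrable (b1 t)).1.
have E2 s : (\int[mu]_t (g (t, s))%:E)%E = (\int[mu]_t g (t, s))%:E.
  by rewrite /Rintegral fineK//; apply: integrable_fin_num => //; exact: (bounded_by_integrable (b2 s)).1.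
have En t : (\int[mu]_s (`|g (t, s)|)%:E)%E = (\int[mu]_s `|g (t, s)|)%:E.
  by rewrite /Rintegral fineK//; apply: integrable_fin_num => //; exact: (bounded_by_integrable (bn t)).1.
have bN : bounded_by B (C * (2 * `|B|)) (fun t => \int[mu]_s `|g (t, s)|).
  split=> [|t].
    by apply: (@measurable_Rintegral_param _ _ (fun z => `|g z|)); exact: measurableT_comp.
  split; first exact: (bounded_by_integrable (bn t)).2.
  apply: contraNle => tB; apply/eqP; rewrite /Rintegral integral0_eq// => s _.
  by congr EFin; apply/eqP; rewrite normr_eq0; apply: contraTT tB => /gB[]; rewrite -leNgt.
have ig : (mu \x mu)%E.-integrable setT (EFin \o g).
  apply/integrable12ltyP; first exact/measurable_EFinP.
  under eq_integral => t _ do rewrite /= En.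
  have := integrable_fin_num measurableT (bounded_by_integrable bN).1.
  by rewrite fin_numElt => /andP[].
have := Fubini ig.
under eq_integral => t _ do rewrite /= E1.
under [in X in _ = X -> _]eq_integral => t _ do rewrite /= E2.
by move=> h; congr fine.
Qed.

(** The outer integral is moved inwards past one coordinate at a time. *)
Lemma rlint_exchange m (B C : R) (f : R * m.-tuple R -> R) :
  measurable_fun setT f -> (forall z, `|f z| <= C) ->
  (forall z, f z != 0 -> `|z.1| <= B /\ forall i, `|tnth z.2 i| <= B) ->
  \int[mu]_t rlint (fun y => f (t, y)) = rlint (fun y => \int[mu]_t f (t, y)).
Proof.
elim: m f => //= m IH f mf fC fB.
pose g (z : measurableTypeR R * measurableTypeR R) := rlint (fun y => f (z.1, cons_tuple z.2 y)).
have b1 t : bsupp B C (fun y => f (t, y)).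
  split=> [|y]; last by split=> // /fB[].
  by apply: (measurableT_comp mf); exact: measurable_fun_pair.
rewrite (@Rintegral_exchange B (C * (2 * `|B|) ^+ m) g).
- apply: eq_Rintegral => s _; rewrite /g/=.
  apply: (IH (fun z => f (z.1, cons_tuple s z.2))) => [|z|[t y] /= /fB[/= ? h]] //.
    apply: (measurableT_comp mf); apply: measurable_fun_pair => //.
    exact: (@measurable_cons _ _ _ R (cst s) m snd).
  by split => // i; have := h (lift ord0 i); rewrite tnthS.
- apply: (@measurable_rlint_param _ _ _ (fun z : (measurableTypeR R * measurableTypeR R) * m.-tuple R => f (z.1.1, cons_tuple z.1.2 z.2))).
  apply: (measurableT_comp mf); apply: measurable_fun_pair.
    by apply: measurableT_comp => //; exact: measurable_fst.
  apply: (@measurable_cons _ _ _ R (fun z : (measurableTypeR R * measurableTypeR R) * m.-tuple R => z.1.2) m snd) => //.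
  exact: measurableT_comp.
- by move=> [t s]; exact: rlint_norm (bsupp_slice s (b1 t)).
- move=> [t s] gts; split.
    apply: contraNT gts; rewrite -ltNge => tB; rewrite -(rlint0 m); apply/eqP/eq_rlint => y.
    by apply/eqP; apply: contraTT tB => /fB[]; rewrite -leNgt.
  exact: ((bsupp_rlint (b1 t)).2 s).2.
Qed.

End IteratedIntegral.

(** * Tuples as vectors *)

Section TupleGeometry.
Variable R : realType.

Definition tl m (y : m.+1.-tuple R) : m.-tuple R := [tuple of behead y].

Lemma tl_cons m (t : R) (y : m.-tuple R) : tl (cons_tuple t y) = y.
Proof. exact: val_inj. Qed.

Lemma thead_cons m (t : R) (y : m.-tuple R) : thead (cons_tuple t y) = t.
Proof. by []. Qed.

Lemma cons_thead_tl m (y : m.+1.-tuple R) : cons_tuple (thead y) (tl y) = y.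
Proof. by rewrite [RHS]tuple_eta; exact: val_inj. Qed.

Lemma tnth_tl m (y : m.+1.-tuple R) i : tnth (tl y) i = tnth y (lift ord0 i).
Proof. by rewrite -[in RHS](cons_thead_tl y) tnthS. Qed.

Lemma dot_thead m (u v : m.+1.-tuple R) : dot u v = thead u * thead v + dot (tl u) (tl v).
Proof.
by rewrite /dot big_ord_recl; congr (_ + _); apply: eq_bigr => i _; rewrite !tnth_tl.
Qed.

Lemma dot_cons m (a b : R) (u v : m.-tuple R) :
  dot (cons_tuple a u) (cons_tuple b v) = a * b + dot u v.
Proof. by rewrite dot_thead !tl_cons. Qed.

Definition axpy m (c : R) (u v : m.-tuple R) : m.-tuple R :=
  [tuple tnth v i + c * tnth u i | i < m].

Lemma dotC m (u v : m.-tuple R) : dot u v = dot v u.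
Proof. by apply: eq_bigr => i _; rewrite mulrC. Qed.

Lemma dot_axpy m (x : m.-tuple R) c u v : dot x (axpy c u v) = dot x v + c * dot x u.
Proof.
rewrite /dot mulr_sumr -big_split; apply: eq_bigr => i _ /=.
by rewrite tnth_mktuple; ring.
Qed.

Lemma dot_vscaler m (x u : m.-tuple R) c : dot x (vscale c u) = c * dot x u.
Proof.
by rewrite /dot mulr_sumr; apply: eq_bigr => i _; rewrite tnth_map; ring.
Qed.

Lemma dot_vscalel m (x u : m.-tuple R) c : dot (vscale c x) u = c * dot x u.
Proof. by rewrite dotC dot_vscaler dotC. Qed.

Lemma dot_ge0 m (u : m.-tuple R) : 0 <= dot u u.
Proof. by apply: sumr_ge0 => i _; rewrite -expr2 sqr_ge0. Qed.

Lemma vnorm_sqr m (u : m.-tuple R) : vnorm u ^+ 2 = dot u u.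
Proof. by rewrite sqr_sqrtr// dot_ge0. Qed.

Lemma tnth_le_vnorm m (u : m.-tuple R) i : `|tnth u i| <= vnorm u.
Proof.
rewrite -sqrtr_sqr ler_wsqrtr// /dot (bigD1 i)//= -expr2 lerDl.
by apply: sumr_ge0 => j _; rewrite -expr2 sqr_ge0.
Qed.

Lemma vnorm_vscale m (u : m.-tuple R) c : vnorm (vscale c u) = `|c| * vnorm u.
Proof.
by rewrite /vnorm dot_vscalel dot_vscaler mulrA -expr2 sqrtrM ?sqr_ge0// sqrtr_sqr.
Qed.

Lemma vnorm_normalize m (u : m.-tuple R) : 0 < vnorm u -> vnorm (vscale (vnorm u)^-1 u) = 1.
Proof.
by move=> u0; rewrite vnorm_vscale ger0_norm ?invr_ge0 1?ltW// mulVf// gt_eqF.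
Qed.

Lemma vnorm1 m (u : m.-tuple R) : vnorm u = 1 -> dot u u = 1.
Proof. by rewrite -vnorm_sqr => ->; rewrite expr1n. Qed.

Lemma measurable_dot d (T : measurableType d) m (f g : T -> m.-tuple R) :
  measurable_fun setT f -> measurable_fun setT g -> measurable_fun setT (fun z => dot (f z) (g z)).
Proof.
move=> mf mg; apply: measurable_sum => i; apply: measurable_funM.
  by apply: (measurableT_comp (measurable_tnth i)).
by apply: (measurableT_comp (measurable_tnth i)).
Qed.

Lemma measurable_vnorm m : measurable_fun setT (@vnorm R m).
Proof.
rewrite (_ : @vnorm R m = fun u => dot u u `^ 2^-1).
  by apply: (measurableT_comp (measurable_powR 2^-1)); exact: measurable_dot.
by apply/funext => u; rewrite powR12_sqrt ?dot_ge0.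
Qed.

Lemma measurable_normalize m : measurable_fun setT (fun u : m.-tuple R => vscale (vnorm u)^-1 u).
Proof.
apply/measurable_fun_tnthP => i.
rewrite (_ : _ \o _ = fun u => vnorm u `^ (-1) * tnth u i).
  apply: measurable_funM; last exact: measurable_tnth.
  by apply: (measurableT_comp (measurable_powR _)); exact: measurable_vnorm.
by apply/funext => u /=; rewrite tnth_map powR_inv1// sqrtr_ge0.
Qed.

End TupleGeometry.

(** * Rotations as products of shears *)

Section Rotation.
Variable R : realType.
Local Notation mu := (@lebesgue_measure R).

(** Each of the two shears translates one block of coordinates by an amount depending only on the
    other block, hence preserves Lebesgue measure. *)
Definition shear_tl m (w : m.-tuple R) (y : m.+1.-tuple R) : m.+1.-tuple R :=
  cons_tuple (thead y) (axpy (thead y) w (tl y)).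

Definition shear_hd m (v : m.-tuple R) (y : m.+1.-tuple R) : m.+1.-tuple R :=
  cons_tuple (thead y + dot v (tl y)) (tl y).

Lemma measurable_tl m : measurable_fun setT (@tl R m).
Proof. exact: measurable_behead. Qed.

Lemma measurable_shear_tl m (w : m.-tuple R) : measurable_fun setT (shear_tl w).
Proof.
apply: measurable_cons; first exact: measurable_tnth.
apply/measurable_fun_tnthP => i.
rewrite (_ : _ \o _ = fun y => tnth (tl y) i + thead y * tnth w i); last first.
  by apply/funext => y /=; rewrite tnth_mktuple.
apply: measurable_funD.
  by apply: (measurableT_comp (measurable_tnth i)); exact: measurable_tl.
by apply: measurable_funM; [exact: measurable_tnth|exact: measurable_cst].
Qed.

Lemma measurable_shear_hd m (v : m.-tuple R) : measurable_fun setT (shear_hd v).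
Proof.
apply: measurable_cons; last exact: measurable_tl.
apply: measurable_funD; first exact: measurable_tnth.
by apply: measurable_dot; [exact: measurable_cst|exact: measurable_tl].
Qed.

Lemma bsupp_shear_tl m (w : m.-tuple R) (B C : R) f : bsupp B C f ->
  exists B', bsupp B' C (f \o shear_tl w).
Proof.
(* On the support the head is at most [B], so undoing the shear moves tail entry [j] by at most
   [B * |w_j| <= B * vnorm w]. *)
move=> [mf bf]; exists (B + `|B| * vnorm w); split=> [|y].
  exact: (measurableT_comp mf (measurable_shear_tl w)).
have [h1 h2] := bf (shear_tl w y); split => // /h2 h i /=.
have h0 : `|thead y| <= B by have := h ord0; rewrite tnth0.
have w0 : 0 <= vnorm w by exact: sqrtr_ge0.
have B0 : 0 <= B by exact: le_trans h0.
rewrite (ger0_norm B0).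
case: (unliftP ord0 i) => [j ->|->]; last first.
  by apply: (le_trans h0); rewrite lerDl mulr_ge0.
have := h (lift ord0 j); rewrite tnthS tnth_mktuple tnth_tl => hj.
have := ler_normB (tnth y (lift ord0 j) + thead y * tnth w j) (thead y * tnth w j).
rewrite addrK => /le_trans; apply; apply: lerD => //.
by rewrite normrM ler_pM// tnth_le_vnorm.
Qed.

Lemma dot_norm_le m (v y : m.-tuple R) B : (forall i, `|tnth y i| <= B) ->
  `|dot v y| <= B * \sum_(i < m) `|tnth v i|.
Proof.
move=> yB; rewrite mulr_sumr; apply: le_trans (ler_norm_sum _ _ _) _.
by apply: ler_sum => i _; rewrite normrM mulrC ler_wpM2r.
Qed.

Lemma bsupp_shear_hd m (v : m.-tuple R) (B C : R) f : bsupp B C f ->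
  exists B', bsupp B' C (f \o shear_hd v).
Proof.
move=> [mf bf]; exists (B + B * \sum_(i < m) `|tnth v i|); split=> [|y].
  exact: (measurableT_comp mf (measurable_shear_hd v)).
have [h1 h2] := bf (shear_hd v y); split => // /h2 h i /=.
have h0 : `|thead y + dot v (tl y)| <= B by have := h ord0; rewrite tnth0.
have hj j : `|tnth (tl y) j| <= B by have := h (lift ord0 j); rewrite tnthS.
have B0 : 0 <= B by exact: le_trans h0.
case: (unliftP ord0 i) => [j ->|->]; last first.
  have := ler_normB (thead y + dot v (tl y)) (dot v (tl y)).
  by rewrite addrK => /le_trans; apply; apply: lerD => //; exact: dot_norm_le.
rewrite -tnth_tl; apply: (le_trans (hj j)); rewrite lerDl mulr_ge0//.
by apply: sumr_ge0.
Qed.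

Lemma rlint_shear_tl m (w : m.-tuple R) (B C : R) f : bsupp B C f ->
  rlint (f \o shear_tl w) = rlint f.
Proof.
move=> bf /=; apply: eq_Rintegral => t _.
rewrite -(rlint_translate [tuple t * tnth w i | i < m] (bsupp_slice t bf)).
apply: eq_rlint => y; congr f; rewrite /shear_tl thead_cons tl_cons.
congr cons_tuple; apply: eq_from_tnth => i.
by rewrite !tnth_mktuple.
Qed.

(** Makes the head the innermost variable, so that a shear of the head becomes a translation on the
    line for each fixed tail. *)
Lemma rlint_swap m (B C : R) (f : m.+1.-tuple R -> R) : bsupp B C f ->
  rlint f = rlint (fun y => \int[mu]_t f (cons_tuple t y)).
Proof.
move=> [mf bf]; apply: (@rlint_exchange R m B C (fun z => f (cons_tuple z.1 z.2))).
- by apply: (measurableT_comp mf); exact: (@measurable_cons _ _ _ R fst m snd).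
- by move=> z; exact: (bf _).1.
- move=> z /(bf _).2 h; split; first by have := h ord0; rewrite tnth0.
  by move=> i; have := h (lift ord0 i); rewrite tnthS.
Qed.

Lemma bounded_by_slice_hd m (B C : R) (f : m.+1.-tuple R -> R) y : bsupp B C f ->
  bounded_by B C (fun t => f (cons_tuple t y)).
Proof.
move=> [mf bf]; split=> [|t].
  by apply: (measurableT_comp mf); exact: (@measurable_cons _ _ _ R id m (cst y)).
by split; [exact: (bf _).1|move=> /(bf _).2 /(_ ord0); rewrite tnth0].
Qed.

Lemma rlint_shear_hd m (v : m.-tuple R) (B C : R) f : bsupp B C f ->
  rlint (f \o shear_hd v) = rlint f.
Proof.
move=> bf; have [B' bf'] := bsupp_shear_hd v bf.
rewrite (rlint_swap bf) (rlint_swap bf'); apply: eq_rlint => y.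
rewrite -(Rintegral_translate (dot v y) (bounded_by_slice_hd y bf)).
by apply: eq_Rintegral => t _; rewrite /= /shear_hd thead_cons tl_cons.
Qed.

(* The rotation in the plane of [x] and the first basis vector [e] that maps
   [x] to [e]; being a plane rotation it is a product of three shears. *)
Definition rot m (x y : m.+1.-tuple R) : m.+1.-tuple R :=
  cons_tuple (dot x y) (axpy (- (thead y + dot x y) / (1 + thead x)) (tl x) (tl y)).

(** With [thead x = cos θ], the outer shears have slope [- tan (θ/2) = - sin θ / (1 + cos θ)] and
    the middle one [sin θ]. The formula breaks down only at the antipode of the first basis vector,
    where [θ = π]. *)
Lemma rot_shears m (x y : m.+1.-tuple R) : dot x x = 1 -> 1 + thead x != 0 ->
  rot x y = let A := shear_tl (vscale (- (1 + thead x)^-1) (tl x)) in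
            A (shear_hd (tl x) (A y)).
Proof.
move=> x1 x0; rewrite /= /shear_tl /shear_hd !thead_cons !tl_cons dot_axpy dot_vscaler.
have e : dot (tl x) (tl x) = 1 - thead x ^+ 2 by rewrite -x1 dot_thead; ring.
(* After two of the three shears the head already has its final value; the last shear only corrects
   the tail. *)
have e0 : thead y + (dot (tl x) (tl y) + thead y * (- (1 + thead x)^-1 * dot (tl x) (tl x))) = dot x y.
  by rewrite e [RHS]dot_thead; field.
rewrite e0 /rot; congr cons_tuple; apply: eq_from_tnth => i.
by rewrite !tnth_mktuple !tnth_map; field.
Qed.

Lemma rlint_rot m (x : m.+1.-tuple R) (B C : R) f : dot x x = 1 -> 1 + thead x != 0 ->
  bsupp B C f -> rlint (f \o rot x) = rlint f.
Proof.
move=> x1 x0 bf; set w := vscale (- (1 + thead x)^-1) (tl x).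
have [B1 b1] := bsupp_shear_tl w bf.
have [B2 b2] := bsupp_shear_hd (tl x) b1.
rewrite -[RHS](rlint_shear_tl w bf) -[RHS](rlint_shear_hd (tl x) b1) -[RHS](rlint_shear_tl w b2).
by apply: eq_rlint => y; rewrite /= rot_shears.
Qed.

Lemma dot_rot m (x y : m.+1.-tuple R) : dot x x = 1 -> 1 + thead x != 0 ->
  dot (rot x y) (rot x y) = dot y y.
Proof.
move=> x1 x0; rewrite /rot dot_cons dot_axpy ![dot (axpy _ _ _) _]dotC !dot_axpy.
have e : dot (tl x) (tl x) = 1 - thead x ^+ 2 by rewrite -x1 dot_thead; ring.
rewrite e (dotC (tl y) (tl x)) (dot_thead y y) (dot_thead x y).
by field.
Qed.

Lemma rot_vscale m (x y : m.+1.-tuple R) c : rot x (vscale c y) = vscale c (rot x y).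
Proof.
apply: eq_from_tnth => i; rewrite tnth_map.
case: (unliftP ord0 i) => [j ->|->]; last by rewrite /rot !tnth0 dot_vscaler.
rewrite /rot !tnthS !tnth_mktuple !tnth_tl /thead !tnth_map dot_vscaler.
by ring.
Qed.

End Rotation.

(** * Spherical means *)

Section SphereMean.
Variable R : realType.
Local Notation mu := (@lebesgue_measure R).

Definition cone m (f : m.-tuple R -> R) (y : m.-tuple R) : R :=
  if (0 < vnorm y) && (vnorm y <= 1) then f (vscale (vnorm y)^-1 y) else 0.

(** The bound is asked on the sphere only, where [cone] evaluates [f]; polynomials in the
    coordinates thus qualify. *)
Definition sphere_bounded m (f : m.-tuple R -> R) : Prop :=
  measurable_fun setT f /\ exists C, forall u, vnorm u = 1 -> `|f u| <= C.

Lemma sphere_bounded_cst m c : @sphere_bounded m (fun _ => c).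
Proof. by split; [exact: measurable_cst|exists `|c|]. Qed.

Lemma sphere_boundedD m (f g : m.-tuple R -> R) :
  sphere_bounded f -> sphere_bounded g -> sphere_bounded (fun y => f y + g y).
Proof.
move=> [mf [C fC]] [mg [D gD]]; split; first exact: measurable_funD.
by exists (C + D) => u u1; rewrite (le_trans (ler_normD _ _))// lerD ?fC ?gD.
Qed.

Lemma sphere_boundedM m (f g : m.-tuple R -> R) :
  sphere_bounded f -> sphere_bounded g -> sphere_bounded (fun y => f y * g y).
Proof.
move=> [mf [C fC]] [mg [D gD]]; split; first exact: measurable_funM.
by exists (C * D) => u u1; rewrite normrM ler_pM ?fC ?gD.
Qed.

Lemma sphere_boundedX m (f : m.-tuple R -> R) k :
  sphere_bounded f -> sphere_bounded (fun y => f y ^+ k).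
Proof.
move=> bf; elim: k => [|k IH]; first exact: sphere_bounded_cst.
by under eq_fun do rewrite exprS; exact: sphere_boundedM.
Qed.

Lemma sphere_bounded_sum m (I : Type) (s : seq I) (f : I -> m.-tuple R -> R) :
  (forall i, sphere_bounded (f i)) -> sphere_bounded (fun y => \sum_(i <- s) f i y).
Proof.
move=> bf; elim: s => [|i s IH].
  by under eq_fun do rewrite big_nil; exact: sphere_bounded_cst.
by under eq_fun do rewrite big_cons; exact: sphere_boundedD.
Qed.

Lemma sphere_bounded_tnth m i : sphere_bounded (fun y : m.-tuple R => tnth y i).
Proof.
split; first exact: measurable_tnth.
by exists 1 => u u1; rewrite -u1 tnth_le_vnorm.
Qed.

Lemma sphere_bounded_dot m (x : m.-tuple R) : sphere_bounded (dot x).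
Proof.
apply: sphere_bounded_sum => i; apply: sphere_boundedM; first exact: sphere_bounded_cst.
exact: sphere_bounded_tnth.
Qed.

Lemma bsupp_cone m (f : m.-tuple R -> R) : sphere_bounded f -> exists C, bsupp 1 C (cone f).
Proof.
move=> [mf [C fC]]; exists `|C|; split=> [|y].
  apply: measurable_fun_ifT; last exact: measurable_cst.
    apply: measurable_and.
      by apply: measurable_fun_ltr; [exact: measurable_cst|exact: measurable_vnorm].
    by apply: measurable_fun_ler; [exact: measurable_vnorm|exact: measurable_cst].
  exact: (measurableT_comp mf (@measurable_normalize R m)).
rewrite /cone; case: ifP => [/andP[y0 y1]|_]; last by rewrite normr0 eqxx.
split=> [|_ i]; last exact: le_trans (tnth_le_vnorm y i) y1.
by rewrite (le_trans (fC _ (vnorm_normalize y0)))// ler_norm.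
Qed.

Lemma eq_cone m (f g : m.-tuple R -> R) : (forall u, vnorm u = 1 -> f u = g u) ->
  cone f =1 cone g.
Proof.
move=> fg y; rewrite /cone; case: ifP => // /andP[y0 _].
by rewrite fg// vnorm_normalize.
Qed.

Lemma le_rlint m (B C D : R) (f g : m.-tuple R -> R) : bsupp B C f -> bsupp B D g ->
  (forall y, f y <= g y) -> rlint f <= rlint g.
Proof.
elim: m f g => //= m IH f g bf bg fg.
apply: le_Rintegral => //; [exact: rlint_integrable bf|exact: rlint_integrable bg|].
by move=> t _; apply: (IH _ _ (bsupp_slice t bf) (bsupp_slice t bg)).
Qed.

Lemma rlint_prod m (phi : R -> R) (B : R) : bounded_by B 1 phi ->
  bsupp B 1 (fun y : m.-tuple R => \prod_(i < m) phi (tnth y i)) /\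
  rlint (fun y : m.-tuple R => \prod_(i < m) phi (tnth y i)) = (\int[mu]_t phi t) ^+ m.
Proof.
move=> [mphi bphi].
have b n : bsupp B 1 (fun y : n.-tuple R => \prod_(i < n) phi (tnth y i)).
  split=> [|y].
    apply: measurable_prod => i _.
    exact: (measurableT_comp mphi (measurable_tnth i)).
  rewrite normr_prod prodr_ile1 => [|i _]; last by rewrite normr_ge0; exact: (bphi _).1.
  by split=> // /prodf_neq0 h i; apply: (bphi _).2; exact: h.
split=> //; elim: m => [|m IH] /=; first by rewrite big_ord0.
rewrite exprS -IH -RintegralZr//; last first.
  by apply: (bounded_by_integrable (B := B) (C := 1) _).1; split.
apply: eq_Rintegral => t _; rewrite -(rlintZ _ (b m)); apply: eq_rlint => y.
rewrite big_ord_recl tnth0; congr (_ * _).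
by apply: eq_bigr => i _; rewrite tnthS.
Qed.

Definition ball_volume m : R := rlint (cone (fun _ : m.-tuple R => 1)).

(** In dimension [m.+1] the ball contains the cube []0, a]^(m.+1)] with [a = 1/(m.+1)]: there each
    square is at most [a], as [a <= 1], and the squares sum to at most 1. The indicator of the cube
    is a product, integrated by [rlint_prod]. *)
Lemma ball_volume_gt0 m : 0 < ball_volume m.+1.
Proof.
pose a : R := (m.+1%:R)^-1.
have a0 : 0 < a by rewrite invr_gt0 ltr0n.
have a1 : a <= 1 by rewrite invf_le1 ?ltr0n// ler1n.
pose phi : R -> R := \1_(`]0, a]).
have bphi : bounded_by 1 1 phi.
  split=> [|t]; first by rewrite /phi; exact: measurable_indic.
  rewrite /phi indicE; case: (boolP (t \in _)) => [|_]; last by rewrite normr0 eqxx.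
  rewrite inE/= in_itv/= normr1 => /andP[t0 ta]; split=> // _.
  by rewrite ger0_norm ?(le_trans ta)// ltW.
have [b e] := rlint_prod m.+1 bphi.
have [C bc] := bsupp_cone (sphere_bounded_cst m.+1 1).
have phiE : \int[mu]_t phi t = a.
  rewrite /Rintegral /phi integral_indic//.
  rewrite setIT; have h z : z = mu `]0, a]%classic -> fine z = a.
    by move=> ->; rewrite lebesgue_measure_itv/= lte_fin a0/= subr0.
  exact: h.
apply: (@lt_le_trans _ _ (a ^+ m.+1)); first by rewrite exprn_gt0.
rewrite -phiE -e; apply: (le_rlint b bc) => y.
rewrite /cone; have [/existsP[i /eqP yi]|/existsPn yn] := boolP [exists i, phi (tnth y i) == 0].
  by rewrite (bigD1 i)//= yi mul0r; case: ifP.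
have {}yn i : 0 < tnth y i <= a.
  by have := yn i; rewrite /phi indicE; case: (boolP (_ \in _)); rewrite ?eqxx// inE/= in_itv.
have -> : 0 < vnorm y.
  apply: lt_le_trans (tnth_le_vnorm y ord0).
  by rewrite normr_gt0 gt_eqF//; case/andP: (yn ord0).
have -> : vnorm y <= 1.
  rewrite -(@ler_pXn2r _ 2)// ?nnegrE ?sqrtr_ge0// vnorm_sqr expr1n.
  apply: (@le_trans _ _ (\sum_(i < m.+1) a)); last first.
    by rewrite sumr_const card_ord -mulr_natr mulVf// pnatr_eq0.
  apply: ler_sum => i _; have /andP[i0 ia] := yn i.
  by rewrite -[leRHS]mulr1; apply: ler_pM => //; [exact: ltW|exact: ltW|exact: le_trans ia a1].
apply: prodr_ile1 => i _; rewrite /phi indicE.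
by case: (_ \in _); rewrite ?lexx ?ler01.
Qed.

Definition sphere_mean m (f : m.-tuple R -> R) : R := rlint (cone f) / ball_volume m.

Lemma sph_int_mean d (f : pt R d -> R) : sphere_bounded f ->
  sph_int (fun y => (f y)%:E) = (sphere_mean f)%:E.
Proof.
move=> bf; rewrite /sph_int.
have coneE g : cone_integrand (fun y : pt R d => (g y)%:E) = (fun y => (cone g y)%:E).
  by apply/funext => y; rewrite /cone_integrand /cone; case: ifP.
have [C bc] := bsupp_cone bf; have [D b1] := bsupp_cone (sphere_bounded_cst d.+1 1).
by rewrite !coneE (lintE bc) (lintE b1).
Qed.

Lemma eq_sphere_mean m (f g : m.-tuple R -> R) :
  (forall u, vnorm u = 1 -> f u = g u) -> sphere_mean f = sphere_mean g.
Proof. by move=> fg; congr (_ / _); apply/eq_rlint/eq_cone. Qed.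

Lemma sphere_mean_cst m (c : R) : sphere_mean (fun _ : m.+1.-tuple R => c) = c.
Proof.
have [C b1] := bsupp_cone (sphere_bounded_cst m.+1 1).
rewrite /sphere_mean (@eq_rlint _ _ _ (fun y => c * cone (fun=> 1) y)).
  by rewrite (rlintZ _ b1) mulfK// gt_eqF// ball_volume_gt0.
by move=> y; rewrite /cone; case: ifP; rewrite ?mulr1 ?mulr0.
Qed.

Lemma sphere_meanD m (f g : m.-tuple R -> R) : sphere_bounded f -> sphere_bounded g ->
  sphere_mean (fun y => f y + g y) = sphere_mean f + sphere_mean g.
Proof.
move=> /bsupp_cone[C bf] /bsupp_cone[D bg].
rewrite /sphere_mean -mulrDl -(rlintD bf bg); congr (_ / _); apply: eq_rlint => y.
by rewrite /cone; case: ifP; rewrite ?addr0.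
Qed.

Lemma sphere_meanZ m (c : R) (f : m.-tuple R -> R) : sphere_bounded f ->
  sphere_mean (fun y => c * f y) = c * sphere_mean f.
Proof.
move=> /bsupp_cone[C bf].
rewrite /sphere_mean mulrA -(rlintZ _ bf); congr (_ / _); apply: eq_rlint => y.
by rewrite /cone; case: ifP; rewrite ?mulr0.
Qed.

Lemma sphere_mean_sum m (I : Type) (s : seq I) (f : I -> m.+1.-tuple R -> R) :
  (forall i, sphere_bounded (f i)) ->
  sphere_mean (fun y => \sum_(i <- s) f i y) = \sum_(i <- s) sphere_mean (f i).
Proof.
move=> bf; elim: s => [|i s IH].
  rewrite big_nil -[RHS](sphere_mean_cst m 0); apply: eq_sphere_mean => u _.
  by rewrite big_nil.
rewrite big_cons -IH -sphere_meanD//; last exact: sphere_bounded_sum.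
by apply: eq_sphere_mean => u _; rewrite big_cons.
Qed.

(** A rotation preserves the norm and commutes with scaling, so it commutes with the extension
    [cone]. *)
Lemma sphere_mean_rot m (x : m.+1.-tuple R) f : dot x x = 1 -> 1 + thead x != 0 ->
  sphere_bounded f -> sphere_mean (f \o rot x) = sphere_mean f.
Proof.
move=> x1 x0 /bsupp_cone[C bf]; rewrite /sphere_mean -(rlint_rot x1 x0 bf).
congr (_ / _); apply: eq_rlint => y.
by rewrite /= /cone /= rot_vscale /vnorm dot_rot.
Qed.

End SphereMean.

(** * Moments and the Stein identity *)

Section SphereMoments.
Variable R : realType.

(** The difference has as roots the integers from 0 up to its size, exclusive: too many for a
    nonzero polynomial. *)
Lemma eq_horner_poly (p q : {poly R}) : (forall a, p.[a] = q.[a]) -> p = q.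
Proof.
move=> pq; apply/eqP; rewrite -subr_eq0; apply/eqP.
apply: (@roots_geq_poly_eq0 _ _ [seq i%:R | i <- iota 0 (size (p - q))]).
- by apply/allP => a _; rewrite /root hornerD hornerN pq subrr.
- by rewrite map_inj_uniq ?iota_uniq//; exact: mulrIn (oner_neq0 R).
- by rewrite size_map size_iota.
Qed.

Lemma sphere_bounded_thead m : sphere_bounded (fun y : m.+1.-tuple R => thead y).
Proof. exact: sphere_bounded_tnth. Qed.

Lemma sphere_bounded_horner m (p : {poly R}) (f : m.-tuple R -> R) :
  sphere_bounded f -> sphere_bounded (fun y => p.[f y]).
Proof.
move=> bf; under eq_fun do rewrite horner_coef.
apply: sphere_bounded_sum => i; apply: sphere_boundedM; first exact: sphere_bounded_cst.
exact: sphere_boundedX.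
Qed.

Lemma sphere_mean_rot_dot m (x : m.+1.-tuple R) (p : {poly R}) :
  dot x x = 1 -> 1 + thead x != 0 ->
  sphere_mean (fun y => p.[dot x y]) = sphere_mean (fun y : m.+1.-tuple R => p.[thead y]).
Proof.
move=> x1 x0.
exact: (sphere_mean_rot x1 x0 (sphere_bounded_horner p (@sphere_bounded_thead m))).
Qed.

Section Dimension.
Variable d : nat.
Hypothesis d_gt0 : (0 < d)%N.

Definition moment (k : nat) : R := sphere_mean (fun y : pt R d => thead y ^+ k).

Lemma moment0 : moment 0 = 1.
Proof.
rewrite -[RHS](sphere_mean_cst d 1); apply: eq_sphere_mean => u _.
by rewrite expr0.
Qed.

(** Rotation invariance for the unit vector with head [a] and a single other entry [b]. *)
Lemma moment_plane (i : 'I_d) (a b : R) k : a ^+ 2 + b ^+ 2 = 1 -> 1 + a != 0 ->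
  sphere_mean (fun y : pt R d => (a * thead y + b * tnth (tl y) i) ^+ k) = moment k.
Proof.
move=> ab a0; pose x : pt R d := cons_tuple a [tuple b *+ (j == i) | j < d].
have xE (y : pt R d) : dot x y = a * thead y + b * tnth (tl y) i.
  rewrite dot_thead thead_cons tl_cons; congr (_ + _).
  rewrite /dot (bigD1 i)//= tnth_mktuple eqxx mulr1n big1 ?addr0// => j ji.
  by rewrite tnth_mktuple (negbTE ji) mulr0n mul0r.
have x1 : dot x x = 1.
  by rewrite xE /x thead_cons tl_cons tnth_mktuple eqxx mulr1n -!expr2.
have := sphere_mean_rot_dot 'X^k x1 a0.
rewrite /moment; under [in X in X = _ -> _]eq_fun do rewrite hornerXn xE.
by under [in X in _ = X -> _]eq_fun do rewrite hornerXn.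
Qed.

(** The moments along a second basis vector and along its opposite both equal [moment k], yet differ
    by a sign. The first basis vector cannot be used, its opposite being excluded by
    [1 + a != 0]. *)
Lemma moment_odd k : odd k -> moment k = 0.
Proof.
move=> ok; pose i := Ordinal d_gt0.
have e1 := @moment_plane i 0 1 k; have e2 := @moment_plane i 0 (-1) k.
have : moment k = - moment k; last by lra.
rewrite -[LHS]e2 ?sqrrN ?expr0n ?expr1n ?add0r ?addr0 ?oner_neq0//.
rewrite -[in RHS]e1 ?expr0n ?expr1n ?add0r ?addr0 ?oner_neq0//.
rewrite -[RHS]mulN1r -sphere_meanZ.
  by apply: eq_sphere_mean => u _; rewrite !mul0r !add0r exprMn mul1r -signr_odd ok.
apply/sphere_boundedX; under eq_fun do rewrite mul0r add0r mul1r tnth_tl.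
exact: sphere_bounded_tnth.
Qed.

(** Normalizing the direction [(1, b)] by its length [r] reduces to [moment_plane]; homogeneity
    gives the factor [r ^+ (2 * k)]. *)
Lemma moment_line (i : 'I_d) (b : R) k :
  sphere_mean (fun y : pt R d => (thead y + b * tnth (tl y) i) ^+ (k * 2)) =
  (1 + b ^+ 2) ^+ k * moment (k * 2).
Proof.
pose r := Num.sqrt (1 + b ^+ 2).
have r0 : 0 < r by rewrite sqrtr_gt0 ltr_pwDl// sqr_ge0.
have r2 : r ^+ 2 = 1 + b ^+ 2 by rewrite sqr_sqrtr// addr_ge0// sqr_ge0.
have rn0 : r != 0 by rewrite gt_eqF.
rewrite -r2 -exprM mulnC -(@moment_plane i r^-1 (b / r)); first last.
- by rewrite gt_eqF// addr_gt0 ?invr_gt0.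
- by rewrite expr_div_n exprVn -[X in X + _]mul1r -mulrDl -r2 divff// expf_neq0.
rewrite -sphere_meanZ.
  by apply: eq_sphere_mean => u _; rewrite -exprMn; congr (_ ^+ _); field.
apply: sphere_boundedX; under eq_fun do rewrite tnth_tl.
by apply: sphere_boundedD; apply: sphere_boundedM;
  [exact: sphere_bounded_cst|exact: sphere_bounded_tnth
  |exact: sphere_bounded_cst|exact: sphere_bounded_tnth].
Qed.

Lemma moment_cross (i : 'I_d) k :
  (2 * k + 1)%:R * sphere_mean (fun y : pt R d => thead y ^+ (k * 2) * tnth (tl y) i ^+ 2)
  = moment (k.+1 * 2).
Proof.
(* Compare the coefficients of [b ^+ 2] in [moment_line]. *)
set n := (k.+1 * 2)%N.
pose M j := sphere_mean (fun y : pt R d => thead y ^+ (n - j) * tnth (tl y) i ^+ j).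
have bM j : sphere_bounded (fun y : pt R d => thead y ^+ (n - j) * tnth (tl y) i ^+ j).
  under eq_fun do rewrite tnth_tl.
  by apply: sphere_boundedM; apply: sphere_boundedX; exact: sphere_bounded_tnth.
have PQ : \sum_(j < n.+1) ('C(n, j)%:R * M j) *: 'X^j = moment n *: (1 + 'X^2) ^+ k.+1.
  apply: eq_horner_poly => b; rewrite hornerZ horner_exp hornerD hornerC hornerXn.
  rewrite [RHS]mulrC -(moment_line i) horner_sum.
  under eq_bigr => j _ do rewrite hornerZ hornerXn mulrAC -sphere_meanZ//.
  rewrite -sphere_mean_sum; last first.
    by move=> j; apply: sphere_boundedM => //; exact: sphere_bounded_cst.
  apply: eq_sphere_mean => u _; rewrite exprDn; apply: eq_bigr => j _.
  by rewrite exprMn -mulr_natr; ring.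
have := congr1 (fun p : {poly R} => p`_2) PQ.
rewrite /= coefZ exprDn !coef_sum (bigD1 (inord 2))//= [X in _ + X]big1 => [|j j2]; last first.
  rewrite coefZ coefXn (_ : (2 == j)%N = false) ?mulr0//; apply/negbTE.
  by apply: contra j2 => /eqP j2; rewrite -val_eqE/= inordK ?j2// /n; lia.
rewrite [in RHS](bigD1 (inord 1))//= [X in _ = _ * (_ + X)]big1 => [|j j1]; last first.
  rewrite expr1n mul1r -exprM coefMn coefXn (_ : (2 == 2 * j)%N = false) ?mul0rn//.
  apply/negbTE; apply: contra j1 => /eqP j1; rewrite -val_eqE/= inordK//; lia.
rewrite !inordK; [|by []|by rewrite /n; lia].
rewrite !addr0 coefZ coefXn eqxx mulr1 expr1n mul1r expr1 coefMn coefXn eqxx bin1 bin2.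
(* The left coefficient carries the binomial of [n] over 2, that is [(k+1)(2k+1)]; the right one
   carries [k+1], which cancels. *)
rewrite (_ : (n * n.-1)./2 = (k.+1 * (2 * k + 1))%N); last first.
  by rewrite /n mulnAC muln2 doubleK; lia.
rewrite natrM -mulrA [RHS]mulrC => /(mulfI _) <-; last by rewrite pnatr_eq0.
by rewrite /M (_ : n - 2 = k * 2)%N// /n; lia.
Qed.

(** For even [k], sum [moment_cross] over the [d] tail coordinates, whose squares add up to
    [1 - t^2] on the sphere. For odd [k] both sides vanish. *)
Lemma moment_rec k : k.+1%:R * (moment k - moment k.+2) = d%:R * moment k.+2.
Proof.
have [ok|ek] := boolP (odd k).
  by rewrite !moment_odd//= ?negbK// subrr !mulr0.
have [j ->] : exists j, k = (j * 2)%N by exists k./2; lia.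
rewrite (_ : (j * 2).+2 = j.+1 * 2)%N; last by lia.
transitivity (\sum_(i < d) moment (j.+1 * 2)); last first.
  by rewrite sumr_const card_ord mulr_natl.
under eq_bigr => i _ do rewrite -(moment_cross i).
rewrite -mulr_sumr -sphere_mean_sum; last first.
  move=> i; under eq_fun do rewrite tnth_tl.
  by apply: sphere_boundedM; apply: sphere_boundedX; exact: sphere_bounded_tnth.
rewrite (_ : (j * 2).+1 = 2 * j + 1)%N; last by lia.
congr (_ * _).
rewrite -[- _]mulN1r -sphere_meanZ -?sphere_meanD; try exact/sphere_boundedX/sphere_bounded_thead.
  apply: eq_sphere_mean => u /vnorm1; rewrite dot_thead => u1.
  rewrite -mulr_sumr (_ : \sum_(i < d) _ = dot (tl u) (tl u)); last first.
    by apply: eq_bigr => i _; rewrite expr2.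
  have -> : dot (tl u) (tl u) = 1 - thead u ^+ 2 by rewrite -u1 expr2; ring.
  have -> : thead u ^+ (j.+1 * 2) = thead u ^+ 2 * thead u ^+ (j * 2) by rewrite -exprD.
  by ring.
by apply: sphere_boundedM; [exact: sphere_bounded_cst|exact/sphere_boundedX/sphere_bounded_thead].
Qed.

Definition zonal_mean (p : {poly R}) : R := sphere_mean (fun y : pt R d => p.[thead y]).

Lemma zonal_meanD p q : zonal_mean (p + q) = zonal_mean p + zonal_mean q.
Proof.
rewrite -sphere_meanD; try exact/sphere_bounded_horner/sphere_bounded_thead.
by apply: eq_sphere_mean => u _; rewrite hornerD.
Qed.

Lemma zonal_meanZ a p : zonal_mean (a *: p) = a * zonal_mean p.
Proof.
rewrite -sphere_meanZ; last exact/sphere_bounded_horner/sphere_bounded_thead.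
by apply: eq_sphere_mean => u _; rewrite hornerZ.
Qed.

Lemma zonal_meanB p q : zonal_mean (p - q) = zonal_mean p - zonal_mean q.
Proof. by rewrite -scaleN1r zonal_meanD zonal_meanZ mulN1r. Qed.

Lemma zonal_meanXn k : zonal_mean 'X^k = moment k.
Proof. by apply: eq_sphere_mean => u _; rewrite hornerXn. Qed.

(** By linearity [p] may be a monomial [X^i]: [i = 0] is the vanishing of the first moment, and
    [i = k+1] is [moment_rec k]. *)
Lemma zonal_mean_stein p :
  zonal_mean ((1 - 'X^2) * p^`() - d%:R *: ('X * p)) = 0.
Proof.
rewrite -(coefK p) poly_def.
elim/big_ind: _ => [|q r Hq Hr|i _].
- by rewrite deriv0 !mulr0 scaler0 subr0 -(scale0r 0) zonal_meanZ mul0r.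
- rewrite derivD !mulrDr scalerDr opprD addrACA zonal_meanD Hq Hr addr0 //.
- rewrite derivZ -!scalerAr [d%:R *: _]scalerA [d%:R * _]mulrC -scalerA -scalerBr zonal_meanZ.
  rewrite [X in _ * X](_ : _ = 0) ?mulr0//.
  rewrite derivXn mulrBl mul1r -exprS !zonal_meanB zonal_meanZ !zonal_meanXn.
  case: (nat_of_ord i) => [|k].
    by rewrite !mulr0n mulr0 -(scale0r 0) zonal_meanZ (moment_odd (k := 1))//; ring.
  have zonal_meanMn q : zonal_mean (q *+ k.+1) = k.+1%:R * zonal_mean q.
    by rewrite -scaler_nat zonal_meanZ.
  rewrite mulrnAr -exprD !zonal_meanMn !zonal_meanXn.
  by have := moment_rec k; lra.
Qed.

Lemma sphere_mean_zonal (x : pt R d) p : vnorm x = 1 ->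
  sphere_mean (fun y => p.[dot x y]) = zonal_mean p.
Proof.
(* At the antipode no rotation is available: pass to [- x], which replaces [p(t)] by [p(-t)], of
   equal mean because odd moments vanish. *)
move=> /vnorm1 x1; have [x0|x0] := eqVneq (1 + thead x) 0; last exact: sphere_mean_rot_dot.
pose x' := vscale (-1) x.
have x'1 : dot x' x' = 1 by rewrite dot_vscalel dot_vscaler; lra.
have x'0 : 1 + thead x' != 0.
  by rewrite /x' /thead tnth_map -/(thead x) (_ : thead x = -1); [rewrite gt_eqF//; lra|lra].
transitivity (zonal_mean (p \Po (- 'X))).
  rewrite /zonal_mean -(sphere_mean_rot_dot _ x'1 x'0); apply: eq_sphere_mean => u _.
  by rewrite horner_comp hornerN hornerX dot_vscalel mulN1r opprK.
rewrite -(coefK p) poly_def; elim/big_ind: _ => [|q r Hq Hr|i _].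
- by rewrite comp_poly0.
- by rewrite comp_polyD !zonal_meanD Hq Hr.
- rewrite comp_polyZ !zonal_meanZ comp_Xn_poly exprNn -signr_odd.
  case: (boolP (odd i)) => oi; last by rewrite mul1r.
  rewrite mulN1r -scaleN1r zonal_meanZ zonal_meanXn moment_odd// !mulr0//.
Qed.

End Dimension.
End SphereMoments.

(** * Gegenbauer polynomials *)

Section Gegenbauer.
Variable R : realType.

Section Polynomials.
Variable lam : R.

(** The recurrence of [gegp] with formal polynomials, so that it can be differentiated. *)
Fixpoint geg_pair (n : nat) : {poly R} * {poly R} :=
  match n with
  | 0 => (1, (2 * lam) *: 'X)
  | m.+1 => let: (a, b) := geg_pair m in
      (b, m.+2%:R^-1 *: ((2 * (m.+1%:R + lam)) *: ('X * b) - (m.+1%:R + 2 * lam - 1) *: a))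
  end.

Definition geg n := (geg_pair n).1.

Lemma geg_pairE n : geg_pair n = (geg n, geg n.+1).
Proof. by rewrite /geg /=; case: (geg_pair n). Qed.

Lemma horner_geg n x : (geg n).[x] = gegenbauer lam n x.
Proof.
suff : ((geg_pair n).1.[x], (geg_pair n).2.[x]) = gegp lam x n.
  by rewrite /gegenbauer => <-.
elim: n => [|n /=]; first by rewrite /= !hornerE.
case: (geg_pair n) => a b /= <-; congr pair.
by rewrite hornerZ hornerD hornerN !hornerZ hornerM hornerX [RHS]mulrC mulrA.
Qed.

Lemma geg0 : geg 0 = 1. Proof. by []. Qed.

Lemma geg1 : geg 1 = (2 * lam) *: 'X. Proof. by []. Qed.

Lemma geg_recZ n : n.+2%:R *: geg n.+2 =
  (2 * (n.+1%:R + lam)) *: ('X * geg n.+1) - (n%:R + 2 * lam) *: geg n.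
Proof.
rewrite {1}/geg [geg_pair n.+2]/= geg_pairE /= scalerA divff ?pnatr_eq0// scale1r.
by congr (_ - _ *: _); rewrite -natr1; ring.
Qed.

Let polyCE := (@polyCD R, @polyCM R, @polyCN R, @polyC_natr R, polyC1 R).

Lemma geg_rec n : n.+2%:R * geg n.+2 =
  2 * (n.+1%:R + lam%:P) * 'X * geg n.+1 - (n%:R + 2 * lam%:P) * geg n.
Proof. by have := geg_recZ n; rewrite -!mul_polyC !polyCE => ->; ring. Qed.

Lemma natp_neq0 n : n.+1%:R != 0 :> {poly R}.
Proof. by rewrite -polyC_natr polyC_eq0 pnatr_eq0. Qed.

(** Both relations are carried through one induction. Differentiating the recurrence and eliminating
    [C_n'] by the second gives the next first relation; the recurrence with both old ones gives the
    next second. *)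
Lemma deriv_geg n :
  (geg n.+1)^`() = 'X * (geg n)^`() + (n%:R + 2 * lam%:P) * geg n /\
  'X * (geg n.+1)^`() - (geg n)^`() = n.+1%:R * geg n.+1.
Proof.
elim: n => [|n [I1 I2]].
  rewrite geg1 geg0 derivZ derivX -polyC1 derivC -!mul_polyC !polyCE.
  by split; ring.
have D : n.+2%:R * (geg n.+2)^`() = 2 * (n.+1%:R + lam%:P) * (geg n.+1 + 'X * (geg n.+1)^`())
    - (n%:R + 2 * lam%:P) * (geg n)^`().
  have := congr1 (@deriv R) (geg_recZ n).
  rewrite derivB !derivZ derivM derivX -!mul_polyC !polyCE => ->; ring.
have J1 : (geg n.+2)^`() = 'X * (geg n.+1)^`() + (n.+1%:R + 2 * lam%:P) * geg n.+1.
  apply: (mulfI (natp_neq0 n.+1)); rewrite D.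
  have -> : (geg n)^`() = 'X * (geg n.+1)^`() - n.+1%:R * geg n.+1 by rewrite -I2; ring.
  by rewrite -!natr1; ring.
split=> //; rewrite geg_rec J1.
have E : 'X * ('X * (geg n.+1)^`()) = 'X * (geg n)^`() + n.+1%:R * ('X * geg n.+1).
  by rewrite [n.+1%:R * _]mulrCA -I2; ring.
rewrite mulrDr E I1 -!natr1; ring.
Qed.

(** Eliminating [C_(n+1)'] between the two relations gives [(X^2 - 1) C_n' = (n+1) C_(n+1) - (n + 2
    lam) X C_n]; differentiate and use the first relation again. *)
Lemma geg_ode n : (1 - 'X^2) * (geg n)^`()^`() - (2 * lam + 1) *: ('X * (geg n)^`()) =
  - (n%:R * (n%:R + 2 * lam)) *: geg n.
Proof.
have [I1 I2] := deriv_geg n.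
have E : ('X^2 - 1) * (geg n)^`() = n.+1%:R * geg n.+1 - (n%:R + 2 * lam%:P) * 'X * geg n.
  by rewrite -I2 I1; ring.
have := congr1 (@deriv R) E.
rewrite (_ : n.+1%:R * geg n.+1 - (n%:R + 2 * lam%:P) * 'X * geg n =
  n.+1%:R *: geg n.+1 - (n%:R + 2 * lam) *: ('X * geg n)); last first.
  by rewrite -!mul_polyC !polyCE; ring.
rewrite !derivM !derivB !derivZ !derivM derivX -polyC1 derivC polyC1.
rewrite -!mul_polyC !polyCE I1 -!natr1 => H.
apply/eqP; rewrite -subr_eq0; apply/eqP.
move/eqP: H; rewrite -subr_eq0 => /eqP H.
by rewrite -oppr0 -H; ring.
Qed.

End Polynomials.
End Gegenbauer.

(** * Orthogonality from a three-term recurrence *)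

Section ThreeTermOrthogonality.
Variable R : realType.
Variables (Lam : {poly R} -> R) (Q : nat -> {poly R}) (al : nat -> R).
Hypothesis LamD : forall p q, Lam (p + q) = Lam p + Lam q.
Hypothesis LamZ : forall a p, Lam (a *: p) = a * Lam p.
Hypothesis Q0 : Q 0 = 1.
Hypothesis al0 : al 0 = 0.
Hypothesis al_neq0 : forall n, al n.+1 != 0.
Hypothesis XQ0 : 'X * Q 0 = al 1 *: Q 1.
Hypothesis XQS : forall n, 'X * Q n.+1 = al n.+2 *: Q n.+2 + (1 - al n) *: Q n.
Hypothesis LamQ : forall n, Lam (Q n) = (n == 0)%:R.

Let h n := (Q n).[1].

Let LamB p q : Lam (p - q) = Lam p - Lam q.
Proof. by rewrite -scaleN1r LamD LamZ mulN1r. Qed.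

Let Lam0 : Lam 0 = 0.
Proof. by rewrite -(scale0r 0) LamZ mul0r. Qed.

(** At 1 the recurrence reads [h_(n+1) = a_(n+2) h_(n+2) + (1 - a_n) h_n], which propagates the
    identity. It says that multiplication by [X] is symmetric for the weights [h]. *)
Lemma value1_rec n : al n.+1 * h n.+1 = (1 - al n) * h n.
Proof.
elim: n => [|n IH].
  have := congr1 (horner^~ 1) XQ0.
  by rewrite /= hornerM hornerZ hornerX al0 subr0 => ->.
have := congr1 (horner^~ 1) (XQS n).
rewrite /= hornerM hornerD !hornerZ hornerX -!/(h _) -IH; lra.
Qed.

(** The recurrence expresses [Q_(m+2)] by [X Q_(m+1)] and [Q_m], and [X] is then moved onto the
    other factor and expanded there. Hence an induction on two consecutive indices, starting from
    [Lam (Q_k)]. *)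
Lemma three_term_orthogonal m n : Lam (Q m * Q n) = (m == n)%:R * h n.
Proof.
suff H : (forall n, Lam (Q m * Q n) = (m == n)%:R * h n) /\
         (forall n, Lam (Q m.+1 * Q n) = (m.+1 == n)%:R * h n) by exact: H.1.
have base k : Lam (Q 0 * Q k) = (0 == k)%N%:R * h k.
  rewrite Q0 mul1r LamQ eq_sym; case: k => [|k]; last by rewrite mul0r.
  by rewrite /h Q0 hornerC mulr1.
elim: m {n} => [|m [IH1 IH2]].
  split=> // k; apply: (mulfI (al_neq0 0)).
  rewrite -LamZ scalerAl -XQ0 -mulrA mulrCA.
  case: k => [|[|k]].
  - by rewrite XQ0 -scalerAr LamZ base !mul0r !mulr0.
  - rewrite XQS mulrDr -!scalerAr LamD !LamZ !base !mul0r !mul1r value1_rec; ring.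
  - by rewrite XQS mulrDr -!scalerAr LamD !LamZ !base !mul0r !mulr0 addr0.
split=> // k; apply: (mulfI (al_neq0 m.+1)).
have -> : al m.+2 * Lam (Q m.+2 * Q k) = Lam (Q m.+1 * ('X * Q k)) - (1 - al m) * Lam (Q m * Q k).
  rewrite -!LamZ -LamB; congr Lam.
  rewrite !scalerAl (_ : al m.+2 *: Q m.+2 = 'X * Q m.+1 - (1 - al m) *: Q m); last first.
    by rewrite XQS addrK.
  by ring.
case: k => [|k].
  rewrite XQ0 -scalerAr LamZ IH1 IH2 mul0r mulr0 eqSS.
  case: m {IH1 IH2} => [|m]; last by rewrite !mul0r !mulr0 subr0.
  by rewrite !mul1r /= value1_rec subrr.
rewrite XQS mulrDr -!scalerAr LamD !LamZ !IH1 !IH2 !eqSS.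
have [->|mk] := eqVneq m k.+1.
  rewrite (_ : (k.+2 == k) = false); last by lia.
  by have := value1_rec k.+1; rewrite !mul0r !mul1r; lra.
have [<-|mk'] := eqVneq m.+1 k; last by rewrite !mul0r !mulr0; lra.
by rewrite !mul0r !mul1r value1_rec; lra.
Qed.

(** * Partial sums of the orthogonal family *)

Definition partial_sum n := \sum_(l < n) Q l.

Let Lam_sum (I : Type) (s : seq I) (p : I -> {poly R}) :
  Lam (\sum_(i <- s) p i) = \sum_(i <- s) Lam (p i).
Proof. by elim/big_rec2: _ => // i x y _ <-. Qed.

(** In the summed recurrence each [Q_l] with [l < n] receives [a_l] from below and [1 - a_l] from
    above, total 1; only the two top terms keep a coefficient [a]. *)
Lemma mulX_partial_sum n :
  'X * partial_sum n.+1 = partial_sum n + al n *: Q n + al n.+1 *: Q n.+1.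
Proof.
elim: n => [|n IH].
  by rewrite /partial_sum big_ord_recl !big_ord0 addr0 XQ0 al0 scale0r !add0r.
rewrite {1}/partial_sum big_ord_recr /= -/(partial_sum n.+1) mulrDr IH XQS.
rewrite /partial_sum [in RHS]big_ord_recr /= scalerBl scale1r; ring.
Qed.

Lemma Lam_partial_sumM n k : (n <= k)%N -> Lam (partial_sum n * Q k) = 0.
Proof.
move=> nk; rewrite /partial_sum mulr_suml Lam_sum big1// => i _.
rewrite three_term_orthogonal; have -> : (nat_of_ord i == k) = false.
  by have := ltn_ord i; lia.
by rewrite mul0r.
Qed.

Lemma Lam_partial_sum_sqr n : Lam (partial_sum n * partial_sum n) = (partial_sum n).[1].
Proof.
elim: n => [|n IH]; first by rewrite /partial_sum big_ord0 mulr0 Lam0 horner0.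
have -> : partial_sum n.+1 = partial_sum n + Q n by rewrite /partial_sum big_ord_recr.
have -> : (partial_sum n + Q n) * (partial_sum n + Q n) =
  partial_sum n * partial_sum n + 2 *: (partial_sum n * Q n) + Q n * Q n.
  by rewrite -mul_polyC polyC_natr; ring.
rewrite !LamD LamZ IH Lam_partial_sumM// three_term_orthogonal eqxx hornerD.
by rewrite mulr0 addr0 mul1r.
Qed.

Lemma Lam_mulX_partial_sum_sqr n :
  Lam (('X * partial_sum n.+1) * ('X * partial_sum n.+1)) =
  (partial_sum n).[1] + al n ^+ 2 * h n + al n.+1 ^+ 2 * h n.+1.
Proof.
rewrite mulX_partial_sum.
have -> : (partial_sum n + al n *: Q n + al n.+1 *: Q n.+1) *
   (partial_sum n + al n *: Q n + al n.+1 *: Q n.+1) =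
  partial_sum n * partial_sum n + (2 * al n) *: (partial_sum n * Q n) +
  (2 * al n.+1) *: (partial_sum n * Q n.+1) + (2 * al n * al n.+1) *: (Q n * Q n.+1) +
  (al n ^+ 2) *: (Q n * Q n) + (al n.+1 ^+ 2) *: (Q n.+1 * Q n.+1).
  by rewrite -!mul_polyC !polyCM !polyC_natr; ring.
rewrite !LamD !LamZ Lam_partial_sum_sqr !Lam_partial_sumM// !three_term_orthogonal !eqxx.
rewrite (_ : (n == n.+1) = false); last by lia.
by rewrite !mul1r !mul0r !mulr0 !addr0.
Qed.

End ThreeTermOrthogonality.

(** * The reproducing kernel *)

Section HarmonicKernel.
Variables (R : realType) (d : nat).
Hypothesis d_ge2 : (2 <= d)%N.

Let d_gt0 : (0 < d)%N. Proof. exact: leq_trans d_ge2. Qed.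
Let dR_ge2 : 2 <= d%:R :> R. Proof. by rewrite ler_nat. Qed.
Let nR_ge0 (n : nat) : 0 <= n%:R :> R. Proof. exact: ler0n. Qed.

Let lam : R := (d%:R - 1) / 2.

Definition zonal (l : nat) : {poly R} :=
  ((d + 2 * l - 1)%N%:R / (d - 1)%N%:R) *: geg lam l.

Lemma horner_zonal l x : (zonal l).[x] = Qd d l x.
Proof. by rewrite hornerZ horner_geg. Qed.

Definition zonal_coef (l : nat) : R := l%:R / (d%:R + 2 * l%:R - 1).

Let natr_zonal l : (d + 2 * l - 1)%N%:R = d%:R + 2 * l%:R - 1 :> R.
Proof. by rewrite natrB; [rewrite natrD natrM|lia]. Qed.

Let natr_pred : (d - 1)%N%:R = d%:R - 1 :> R.
Proof. by rewrite natrB. Qed.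

Lemma zonal0 : zonal 0 = 1.
Proof.
have hd := dR_ge2.
by rewrite /zonal muln0 addn0 divff ?scale1r// natr_pred gt_eqF//; lra.
Qed.

Lemma zonal_coef0 : zonal_coef 0 = 0.
Proof. by rewrite /zonal_coef mul0r. Qed.

Lemma zonal_coef_neq0 n : zonal_coef n.+1 != 0.
Proof. have hn := nR_ge0 n.+1.
by rewrite mulf_neq0 ?pnatr_eq0// invr_neq0// gt_eqF//; lra. Qed.

Lemma mulX_zonal0 : 'X * zonal 0 = zonal_coef 1 *: zonal 1.
Proof.
have hd := dR_ge2.
rewrite zonal0 mulr1 /zonal geg1 !scalerA natr_zonal natr_pred /zonal_coef /lam.
rewrite (_ : _ * _ = 1) ?scale1r//.
by field; apply/andP; split; rewrite gt_eqF//; lra.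
Qed.

(** Here [a_(n+2) Q_(n+2)] is [(n+2)/(d-1)] times [C_(n+2)], to which the Gegenbauer recurrence
    applies; the terms in [C_n] then cancel since [n + 2 lam = n + d - 1]. *)
Lemma mulX_zonalS n : 'X * zonal n.+1 =
  zonal_coef n.+2 *: zonal n.+2 + (1 - zonal_coef n) *: zonal n.
Proof.
have hd := dR_ge2.
have hn := nR_ge0 n.
rewrite /zonal -!scalerAr !scalerA !natr_zonal natr_pred /zonal_coef.
have -> : n.+2%:R / (d%:R + 2 * n.+2%:R - 1) * ((d%:R + 2 * n.+2%:R - 1) / (d%:R - 1)) =
   (d%:R - 1)^-1 * n.+2%:R :> R.
  by rewrite -(natr1 n.+1) -(natr1 n); field; apply/andP; split; rewrite gt_eqF//; lra.
rewrite -[(_^-1 * _) *: geg lam n.+2]scalerA geg_recZ scalerBr !scalerA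
  -[RHS]addrA -[- (_ *: geg lam n)]scaleNr -scalerDl.
have -> : - ((d%:R - 1)^-1 * (n%:R + 2 * lam)) + (1 - n%:R / (d%:R + 2 * n%:R - 1)) *
   ((d%:R + 2 * n%:R - 1) / (d%:R - 1)) = 0 :> R.
  by rewrite /lam; field; apply/andP; split; rewrite gt_eqF//; lra.
rewrite scale0r addr0; congr (_ *: _).
by rewrite /lam -(natr1 n); field; rewrite gt_eqF//; lra.
Qed.

(** With [2 lam + 1 = d], the left side of [geg_ode] is the Stein expression of [C_n'], so
    [n (n + 2 lam)] times the mean of [C_n] is 0. *)
Lemma zonal_mean_zonal n : zonal_mean d (zonal n) = (n == 0)%N%:R.
Proof.
have hd := dR_ge2.
case: n => [|n].
  by rewrite zonal0 -(expr0 'X) zonal_meanXn moment0.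
rewrite zonal_meanZ [zonal_mean d (geg _ _)](_ : _ = 0) ?mulr0//.
have := geg_ode lam n.+1; have -> : 2 * lam + 1 = d%:R by rewrite /lam; field.
move=> /(congr1 (zonal_mean d)); rewrite zonal_mean_stein// zonal_meanZ => /esym/eqP.
rewrite mulf_eq0 => /orP[|/eqP//]; rewrite oppr_eq0 mulf_eq0 pnatr_eq0 /=.
have := nR_ge0 n.+1; rewrite /lam => ? /eqP; lra.
Qed.

Definition kernel_poly (L : nat) : {poly R} := partial_sum zonal L.+1.

Lemma horner_kernel_poly L x : (kernel_poly L).[x] = RL d L x.
Proof. by rewrite horner_sum; apply: eq_bigr => l _; exact: horner_zonal. Qed.

Lemma binS L : L.+1%:R * 'C(d + L.+1, d)%:R = (d + L.+1)%:R * 'C(d + L, d)%:R :> R.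
Proof.
have := mul_bin_down (d + L.+1) d; rewrite addnS /= (_ : (d + L).+1 - d = L.+1)%N; last by lia.
by rewrite -!natrM => ->.
Qed.

Let value1_rec' := value1_rec zonal_coef0 mulX_zonal0 mulX_zonalS.

(** This is the dimension of the spherical harmonics of degree [L], written as a multiple of the
    binomial in the final formula. *)
Lemma zonal_value1 L : (zonal L).[1] =
  d%:R * (d%:R + 2 * L%:R - 1) / ((d%:R + L%:R) * (d%:R + L%:R - 1)) * 'C(d + L, d)%:R.
Proof.
have hd := dR_ge2.
elim: L => [|L IH].
  rewrite zonal0 hornerC addn0 binn; field.
  by apply/andP; split; rewrite gt_eqF//; lra.
have hL := nR_ge0 L.
apply: (mulfI (zonal_coef_neq0 L)); rewrite value1_rec' IH.
apply: (mulfI (x := L.+1%:R)); first by rewrite pnatr_eq0.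
have -> : L.+1%:R * (zonal_coef L.+1 * (d%:R * (d%:R + 2 * L.+1%:R - 1) /
  ((d%:R + L.+1%:R) * (d%:R + L.+1%:R - 1)) * 'C(d + L.+1, d)%:R)) =
  zonal_coef L.+1 * (d%:R * (d%:R + 2 * L.+1%:R - 1) /
  ((d%:R + L.+1%:R) * (d%:R + L.+1%:R - 1))) * (L.+1%:R * 'C(d + L.+1, d)%:R) by ring.
rewrite binS /zonal_coef natrD -(natr1 L); field.
by repeat (apply/andP; split); rewrite gt_eqF//; lra.
Qed.

Lemma hdimE L : (hdim d L)%:R = (d%:R + 2 * L%:R) / (d%:R + L%:R) * 'C(d + L, d)%:R :> R.
Proof.
have hd := dR_ge2.
rewrite /hdim natrD; case: L => [|L].
  rewrite addn0 binn (@bin_small (d - 1)); last by lia.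
  by field; rewrite gt_eqF//; lra.
have hL := nR_ge0 L.+1.
have -> : 'C(d + L.+1 - 1, d)%:R = L.+1%:R * 'C(d + L.+1, d)%:R / (d + L.+1)%:R :> R.
  rewrite binS (_ : d + L.+1 - 1 = d + L)%N; last by lia.
  by rewrite mulrAC divff ?mul1r// pnatr_eq0; lia.
by rewrite natrD; field; rewrite gt_eqF//; lra.
Qed.

Lemma kernel_poly1 L : (kernel_poly L).[1] = (hdim d L)%:R.
Proof.
have hd := dR_ge2.
elim: L => [|L IH].
  rewrite /kernel_poly /partial_sum big_ord1 zonal0 hornerC hdimE addn0 binn.
  by field; rewrite gt_eqF//; lra.
have hL := nR_ge0 L.
have -> : kernel_poly L.+1 = kernel_poly L + zonal L.+1.
  by rewrite /kernel_poly /partial_sum big_ord_recr.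
rewrite hornerD IH zonal_value1 !hdimE.
have -> : 'C(d + L, d)%:R = L.+1%:R * 'C(d + L.+1, d)%:R / (d + L.+1)%:R :> R.
  by rewrite binS mulrAC divff ?mul1r// pnatr_eq0; lia.
rewrite natrD -(natr1 L); field.
by repeat (apply/andP; split); rewrite gt_eqF//; lra.
Qed.

(** Since [R_(L-1)(1) = n - Q_L(1)] and [a_(L+1) Q_(L+1)(1) = (1 - a_L) Q_L(1)], the left side is
    [Q_L(1) (1 - a_L^2 - a_(L+1) (1 - a_L))]. *)
Lemma zonal_mean_kernel L :
  (hdim d L)%:R - zonal_mean d (kernel_poly L ^+ 2 * 'X^2) =
  (d%:R / (L + d)%:R
         - (d * (d - 1))%:R / ((d + L) * (d + 2 * L + 1) * (d + 2 * L - 1))%:R)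
        * 'C(d + L, d)%:R.
Proof.
have hd := dR_ge2.
have hL := nR_ge0 L.
have -> : kernel_poly L ^+ 2 * 'X^2 = ('X * kernel_poly L) * ('X * kernel_poly L) by ring.
rewrite (Lam_mulX_partial_sum_sqr (@zonal_meanD R d) (@zonal_meanZ R d) zonal0 zonal_coef0
  zonal_coef_neq0 mulX_zonal0 mulX_zonalS zonal_mean_zonal).
have -> : (partial_sum zonal L).[1] = (hdim d L)%:R - (zonal L).[1].
  by rewrite -kernel_poly1 /kernel_poly /partial_sum big_ord_recr hornerD addrK.
rewrite [zonal_coef L.+1 ^+ 2]expr2 -[_ * _ * (zonal L.+1).[1]]mulrA value1_rec' zonal_value1.
rewrite !natrM !natrD natr_zonal natr_pred ?natrM /zonal_coef -(natr1 L); field.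
by repeat (apply/andP; split); rewrite gt_eqF//; lra.
Qed.

End HarmonicKernel.

(** * The harmonic ensemble *)

Section HarmonicEnsemble.
Variables (R : realType) (d : nat).
Hypothesis d_ge2 : (2 <= d)%N.

Let d_gt0 : (0 < d)%N. Proof. exact: leq_trans d_ge2. Qed.

Lemma eq_sph_int (f g : pt R d -> \bar R) :
  (forall u, vnorm u = 1 -> f u = g u) -> sph_int f = sph_int g.
Proof.
move=> fg; rewrite /sph_int; congr (lint _ * _)%E; apply/funext => y.
rewrite /cone_integrand; case: ifP => // /andP[y0 _].
by rewrite fg// vnorm_normalize.
Qed.

Lemma det_mx22 (A : 'M[R]_2) :
  \det A = A ord0 ord0 * A ord_max ord_max - A ord0 ord_max * A ord_max ord0.
Proof.
rewrite (expand_det_row _ ord0) !big_ord_recl big_ord0 /cofactor !det_mx11 !mxE.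
rewrite (_ : lift ord0 ord0 = ord_max :> 'I_2); last exact: val_inj.
rewrite (_ : lift ord_max ord0 = ord0 :> 'I_2); last exact: val_inj.
by rewrite /= expr0 expr1; ring.
Qed.

Lemma zonal_mean_sqr : zonal_mean d 'X^2 = d.+1%:R^-1 :> R.
Proof.
rewrite zonal_meanXn; have := moment_rec R d_gt0 0; rewrite moment0 mul1r => h.
apply: (mulfI (x := d.+1%:R)); first by rewrite pnatr_eq0.
by rewrite divff ?pnatr_eq0// -natr1; lra.
Qed.

Definition sqdot (y : 2.-tuple (pt R d)) : R := dot (tnth y ord0) (tnth y ord_max) ^+ 2.

(** On the sphere the integrand is [(n^2 - R_L(t)^2) t^2] with [t] the inner product of the two
    points. The inner mean does not depend on the outer point, so the outer mean is that of a
    constant. *)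
Lemma sph_intk2_sqdot L :
  sph_intk (fun y : 2.-tuple (pt R d) => ((rho L y)%:E * (sqdot y)%:E)%E) =
  ((hdim d L)%:R ^+ 2 / d.+1%:R - zonal_mean d (kernel_poly R d L ^+ 2 * 'X^2))%:E.
Proof.
pose p : {poly R} := (hdim d L)%:R ^+ 2 *: 'X^2 - kernel_poly R d L ^+ 2 * 'X^2.
have pE : zonal_mean d p = (hdim d L)%:R ^+ 2 / d.+1%:R - zonal_mean d (kernel_poly R d L ^+ 2 * 'X^2).
  by rewrite /p zonal_meanB zonal_meanZ zonal_mean_sqr.
rewrite -pE /= -[in RHS](sphere_mean_cst d (zonal_mean d p)) -sph_int_mean; last exact: sphere_bounded_cst.
apply: eq_sph_int => u u1.
rewrite -(sphere_mean_zonal d_gt0 p u1) -sph_int_mean; last exact/sphere_bounded_horner/sphere_bounded_dot.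
apply: eq_sph_int => v v1.
rewrite -EFinM; congr EFin.
rewrite /rho /sqdot det_mx22 !mxE.
rewrite (_ : tnth _ ord0 = u)// (_ : tnth _ ord_max = v); last by rewrite (tnth_nth u).
rewrite -!horner_kernel_poly (vnorm1 u1) (vnorm1 v1) kernel_poly1// (dotC v u).
by rewrite /p hornerD hornerN hornerZ [(_ * 'X^2).[_]]hornerM !hornerXn horner_exp; ring.
Qed.

Lemma sum_injective_pairs n (F : 'I_n -> 'I_n -> R) :
  \sum_(s : {ffun 'I_2 -> 'I_n} | injectiveb s) F (s ord0) (s ord_max) =
  \sum_(i < n) \sum_(j < n | j != i) F i j.
Proof.
rewrite pair_big_dep /=.
pose f (z : 'I_n * 'I_n) := [ffun a : 'I_2 => if a == ord0 then z.1 else z.2].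
pose g (s : {ffun 'I_2 -> 'I_n}) := (s ord0, s ord_max).
have ord2 (a : 'I_2) : a = ord0 \/ a = ord_max.
  by case: a => -[|[|//]] ?; [left|right]; exact: val_inj.
rewrite (reindex f); last first.
  exists g => [[i j] _|s _]; first by rewrite /g /f !ffunE.
  by apply/ffunP => a; rewrite /g /f !ffunE; case: (ord2 a) => ->.
apply: eq_big => [[i j]|[i j] _]; last by rewrite !ffunE.
apply/injectiveP/idP => [/(_ ord0 ord_max)|/= ji a b].
  by rewrite !ffunE /= => h; apply/eqP => ji; have := h (esym ji).
case: (ord2 a) => ->; case: (ord2 b) => ->; rewrite !ffunE //= => e;
  by rewrite e eqxx in ji.
Qed.

Lemma expected_frame_potential L (dO : measure_display) (Omega : measurableType dO)
    (P : probability Omega R) (x : 'I_(hdim d L) -> Omega -> pt R d) :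
  harmonic_ensemble P x ->
  EFP P x = ((hdim d L)%:R ^+ 2 / d.+1%:R
      + (d%:R / (L + d)%:R
         - (d * (d - 1))%:R / ((d + L) * (d + 2 * L + 1) * (d + 2 * L - 1))%:R)
        * 'C(d + L, d)%:R)%:E.
Proof.
move=> [mx [sx [_ corr]]]; set n := hdim d L in x mx sx corr *.
rewrite -zonal_mean_kernel//.
have mdot i j : measurable_fun setT (fun w => dot (x i w) (x j w) ^+ 2).
  by apply: measurable_funX; exact: measurable_dot.
pose g w := \sum_(s : {ffun 'I_2 -> 'I_n} | injectiveb s)
  dot (x (s ord0) w) (x (s ord_max) w) ^+ 2.
have g0 w : 0 <= g w by apply: sumr_ge0 => s _; exact: sqr_ge0.
have mg : measurable_fun setT (EFin \o g).
  apply/measurable_EFinP; rewrite /g; under eq_fun do rewrite -big_filter.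
  by apply: measurable_sum => s; exact: mdot.
(* Almost surely the [n] diagonal terms are 1; what remains is the sum over injective pairs, the
   form required by the correlation identity for [k = 2]. *)
have FP_g : {ae P, forall w, setT w -> (FP (fun i => x i w))%:E = (n%:R%:E + (g w)%:E)%E}.
  apply: filterS sx => w x1 _; rewrite -EFinD; congr EFin.
  rewrite /g (@sum_injective_pairs n (fun i j => dot (x i w) (x j w) ^+ 2)) /FP.
  rewrite (_ : n%:R = \sum_(i < n) 1); last by rewrite sumr_const card_ord.
  rewrite -big_split; apply: eq_bigr => i _ /=; rewrite (bigD1 i)//=.
  by rewrite (vnorm1 (x1 i)) expr1n.
have mFP : measurable_fun setT (fun w => (FP (fun i => x i w))%:E).
  by apply/measurable_EFinP; apply: measurable_sum => i; apply: measurable_sum => j; exact: mdot.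
rewrite /EFP (ae_eq_integral (fun w => n%:R%:E + (g w)%:E)%E)//; last exact: emeasurable_funD.
rewrite ge0_integralD//; last by move=> w _; rewrite lee_fin.
have -> : (\int[P]_w n%:R%:E)%E = n%:R%:E.
  by rewrite integral_cst//= probability_setT mule1.
have msq : measurable_fun [set: 2.-tuple (pt R d)] (fun y => (sqdot y)%:E).
  apply/measurable_EFinP; apply: measurable_funX; apply: measurable_dot; exact: measurable_tnth.
have := corr 2 _ msq (fun z => sqr_ge0 _).
rewrite sph_intk2_sqdot => corr2.
rewrite (_ : (\int[P]_w (g w)%:E)%E = ((hdim d L)%:R ^+ 2 / d.+1%:R - zonal_mean d (kernel_poly R d L ^+ 2 * 'X^2))%:E).
  by rewrite -EFinD; congr EFin; rewrite -/n; ring.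
rewrite -corr2; apply: eq_integral => w _; rewrite -sumEFin; apply: eq_bigr => s _.
by rewrite /sqdot !tnth_mktuple.
Qed.

(** * The asymptotic bound on the deviation *)

Lemma bin_le_expn (n k : nat) : ('C(n, k) <= n ^ k)%N.
Proof.
elim: k => [|k IH]; first by rewrite bin0.
apply: (@leq_trans (k.+1 * 'C(n, k.+1))%N); first by rewrite leq_pmull.
by rewrite mul_bin_left expnS leq_mul// leq_subr.
Qed.

(** Let [B] be the binomial. From [B <= (L+d)^d] comes [B^(1/d) <= L + d], so
    [d B / (L+d) <= d B^((d-1)/d)]; finally [B <= n], being one of its two summands. *)
Lemma deviation_bound L :
  `|(d%:R / (L + d)%:R
     - (d * (d - 1))%:R / ((d + L) * (d + 2 * L + 1) * (d + 2 * L - 1))%:R)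
    * 'C(d + L, d)%:R| <= d%:R * (hdim d L)%:R `^ ((d%:R - 1) / d%:R) :> R.
Proof.
set B : R := 'C(d + L, d)%:R; set a : R := (d%:R - 1) / d%:R.
have dR : 2 <= d%:R :> R by rewrite ler_nat.
have LR : 0 <= L%:R :> R by exact: ler0n.
have B0 : 0 < B by rewrite ltr0n bin_gt0 leq_addr.
have a0 : 0 <= a by apply: divr_ge0; lra.
(* The subtracted fraction lies between 0 and [d/(L+d)], so it only lowers the absolute value. *)
have coef_le : `|d%:R / (L + d)%:R
     - (d * (d - 1))%:R / ((d + L) * (d + 2 * L + 1) * (d + 2 * L - 1))%:R|
     <= d%:R / (L + d)%:R :> R.
  set q : R := (X in _ - X); set r : R := _ / _.
  suff /andP[q0 qr] : 0 <= q <= r by rewrite ger0_norm; lra.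
  rewrite /q /r divr_ge0 ?ler0n//= ler_pdivrMr ?ltr0n; last by rewrite !muln_gt0; lia.
  rewrite mulrAC ler_pdivlMr ?ltr0n; last by lia.
  rewrite -!natrM ler_nat -mulnA leq_mul2l; apply/orP; right.
  by rewrite mulnC -mulnA addnC leq_mul2l; apply/orP; right; nia.
have Broot : B `^ (d%:R^-1) <= (L + d)%:R.
  apply: (@le_trans _ _ (((L + d)%:R ^+ d) `^ d%:R^-1)).
    apply: ge0_ler_powR; rewrite ?nnegrE ?invr_ge0 ?exprn_ge0 ?ler0n//.
    by rewrite -natrX ler_nat addnC bin_le_expn.
  by rewrite -powR_mulrn ?ler0n// -powRrM divff ?powRr1 ?ler0n// gt_eqF//; lra.
have Bsplit : B = B `^ a * B `^ d%:R^-1.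
  rewrite -powRD; last by apply/implyP => _; rewrite gt_eqF.
  by rewrite (_ : a + _ = 1) ?powRr1 1?ltW// /a; field; rewrite gt_eqF//; lra.
rewrite normrM (ger0_norm (ltW B0)).
apply: (le_trans (ler_wpM2r (ltW B0) coef_le)).
apply: (@le_trans _ _ (d%:R * B `^ a)); last first.
  rewrite ler_wpM2l// ge0_ler_powR ?nnegrE ?ler0n//.
  by rewrite ler_nat leq_addr.
rewrite {1}Bsplit mulrAC -mulrA -mulrA ler_wpM2l// -[leRHS]mulr1.
rewrite ler_wpM2l ?powR_ge0// ler_pdivrMr ?mul1r// ltr0n; lia.
Qed.

End HarmonicEnsemble.

Theorem theorem1 (R : realType) (d : nat) (hd : (2 <= d)%N) :
  (forall (L : nat) (dO : measure_display) (Omega : measurableType dO)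
          (P : probability Omega R) (x : 'I_(hdim d L) -> Omega -> pt R d),
     harmonic_ensemble P x ->
     EFP P x =
     ((hdim d L)%:R ^+ 2 / d.+1%:R
      + (d%:R / (L + d)%:R
         - (d * (d - 1))%:R / ((d + L) * (d + 2 * L + 1) * (d + 2 * L - 1))%:R)
        * 'C(d + L, d)%:R)%:E)
  /\
  (exists (C : R) (L0 : nat), forall (L : nat), (L0 <= L)%N ->
     forall (dO : measure_display) (Omega : measurableType dO)
            (P : probability Omega R) (x : 'I_(hdim d L) -> Omega -> pt R d),
     harmonic_ensemble P x ->
     (`| EFP P x - ((hdim d L)%:R ^+ 2 / d.+1%:R)%:E |
        <= (C * (hdim d L)%:R `^ ((d%:R - 1) / d%:R))%:E)%E).
Proof.
split=> [L dO Omega P x|]; first exact: expected_frame_potential.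
(* The bound with constant [d] holds for every [L], so the threshold is 0. *)
exists d%:R, 0 => L _ dO Omega P x Hx.
rewrite expected_frame_potential// -EFinB addrC addKr lee_fin.
exact: deviation_bound.
Qed.
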